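(* Let $\Gamma$ be a loop of loops of genus $4$. Then $w^1_3(\Gamma) = 0$.
   Context: Metric graphs. A metric graph is a compact connected metric space obtained from a finite connected graph (loops and multiple edges allowed) by assigning a positive real length to each edge. Its genus is its first Betti number. Loops of loops. A loop of loops of genus $4$ is a trivalent metric graph with $6$ vertices $v_1, v_2, v_3, w_1, w_2, w_3$ and exactly the following edges, of arbitrary positive lengths: a single edge joining $v_i$ to $w_i$ for $i = 1,2,3$; two edges joining $w_1$ to $v_2$; two edges joining $w_2$ to $v_3$; and two edges joining $w_3$ to $v_1$. Divisors. A divisor on a metric graph $\Gamma$ is a finite $\mathbb{Z}$-linear combination of points of $\Gamma$; its degree is the sum of its coefficients; it is effective if all its coefficients are nonnegative. For a continuous piecewise linear function $f$ on $\Gamma$ with integer slopes, $\mathrm{div}(f) = \sum_{v \in \Gamma} \mathrm{ord}_v(f)\, v$, where $\mathrm{ord}_v(f)$ is the sum of the incoming slopes of $f$ at $v$; such divisors are called principal. Two divisors are equivalent if their difference is principal. $\mathrm{Pic}_d(\Gamma)$ is the set of equivalence classes of divisors of degree $d$. Rank. The rank $r(D)$ of a divisor $D$ is $-1$ if $D$ is not equivalent to an effective divisor, and otherwise is the largest integer $r$ such that for every effective divisor $E$ of degree $r$ on $\Gamma$ there is a divisor $D'$ equivalent to $D$ with $D' - E$ effective. Brill-Noether rank. For nonnegative integers $r,d$, $W^r_d(\Gamma) \subset \mathrm{Pic}_d(\Gamma)$ is the set of divisor classes of degree $d$ and rank at least $r$. If $W^r_d(\Gamma)$ is nonempty, $w^r_d(\Gamma)$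 is the largest integer $\rho$ such that, for every effective divisor $E$ of degree $r + \rho$ on $\Gamma$, there exists a divisor $D$ of degree $d$ and rank at least $r$ on $\Gamma$ such that $D - E$ is effective. If $W^r_d(\Gamma)$ is empty then $w^r_d(\Gamma) = -1$. *)

(* Defs.v *)
From HB Require Import structures.
From mathcomp Require Import all_boot all_order all_algebra.
From mathcomp Require Import boolp classical_sets reals.
From mathcomp.multinomials Require Import freeg.

Set Implicit Arguments.
Unset Strict Implicit.
Unset Printing Implicit Defensive.

Import Order.TTheory GRing.Theory Num.Theory.

Local Open Scope classical_set_scope.
Local Open Scope ring_scope.

(* A metric graph is given by a finite connected multigraph (loops allowed),
   with a positive length on each edge.  The orientation of the edges only
   serves to parametrize them. *)
Record metricGraph (R : realType) := MetricGraph {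
  vertex : finType;
  edge : finType;
  src : edge -> vertex;
  tgt : edge -> vertex;
  len : edge -> R;
  len_gt0 : forall e, 0 < len e;
  vertex_gt0 : (0 < #|vertex|)%N;
  graph_connected : forall u v : vertex,
    connect (fun x y => [exists e : edge,
      ((src e == x) && (tgt e == y)) || ((src e == y) && (tgt e == x))]) u v
}.

Section MetricGraphTheory.
Variables (R : realType) (G : metricGraph R).

(* A point is either a vertex or the point at distance t from src e on the
   edge e, with 0 < t < len e. *)
Definition is_point (x : vertex G + edge G * R) : bool :=
  match x with
  | inl _ => true
  | inr (e, t) => 0 < t < len e
  end.

Definition point : Type := {x : vertex G + edge G * R | is_point x}.

Definition vpoint (v : vertex G) : point := exist is_point (inl v) isT.

(* Parametrization [0, len e] -> G of the closed edge e, starting at src e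
   (extended by constants outside of [0, len e]). *)
Definition epoint (e : edge G) (t : R) : point :=
  insubd (vpoint (if t <= 0 then src e else tgt e)) (inr (e, t)).

(* g is piecewise linear with integer slopes on [0, l]: there is a subdivision
   0 = t_0 < t_1 < ... < t_n = l with g affine of integer slope on each of the
   closed intervals [t_i, t_(i+1)]; in particular g is continuous on [0, l]. *)
Definition pl_on (l : R) (g : R -> R) : Prop :=
  exists s : seq R,
    [/\ path <%R 0 s, last 0 s = l &
        forall i : nat, (i < size s)%N ->
        exists m : int, forall t : R, nth 0 (0 :: s) i <= t <= nth 0 s i ->
          g t = g (nth 0 (0 :: s) i) + m%:~R * (t - nth 0 (0 :: s) i)].

(* A function on G is continuous iff its restriction to every closed edge is. *)
Definition piecewise_linear (f : point -> R) : Prop :=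
  forall e : edge G, pl_on (len e) (f \o epoint e).

(* The (integer) slopes of g at t from the right and from the left, both in
   the direction of increasing parameter; they exist for g as above. *)
Definition slope_right (g : R -> R) (t : R) : int :=
  xget 0 [set m : int | exists2 eps : R, 0 < eps &
    forall h : R, 0 <= h <= eps -> g (t + h) = g t + m%:~R * h].

Definition slope_left (g : R -> R) (t : R) : int :=
  xget 0 [set m : int | exists2 eps : R, 0 < eps &
    forall h : R, 0 <= h <= eps -> g (t - h) = g t - m%:~R * h].

(* Sum of the incoming slopes of f at p. At a vertex, a loop contributes twice. *)
Definition ord_at (f : point -> R) (p : point) : int :=
  match val p with
  | inl v => \sum_(e : edge G | tgt e == v) slope_left (f \o epoint e) (len e)
             - \sum_(e : edge G | src e == v) slope_right (f \o epoint e) 0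
  | inr (e, t) => slope_left (f \o epoint e) t - slope_right (f \o epoint e) t
  end.

Definition divisor : Type := {freeg point / int}.

Definition effective (D : divisor) : Prop := forall p : point, 0 <= coeff p D.

Definition is_div (f : point -> R) (D : divisor) : Prop :=
  forall p : point, coeff p D = ord_at f p.

Definition principal (D : divisor) : Prop :=
  exists2 f : point -> R, piecewise_linear f & is_div f D.

Definition equivalent (D D' : divisor) : Prop := principal (D - D').

Definition divisor_class (D : divisor) : set divisor :=
  [set D' | equivalent D D'].

(* The largest element of A. The default value -1 (no largest element) is never
   reached in the definitions below, where A contains 0 and is bounded above. *)
Definition largest (A : set int) : int :=
  xget (-1) [set m | A m /\ forall n, A n -> n <= m].

Definition rank (D : divisor) : int :=
  if `[< exists2 D', equivalent D' D & effective D' >] then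
    largest [set r | forall E, effective E -> deg E = r ->
      exists2 D', equivalent D' D & effective (D' - E)]
  else -1.

Definition BN_locus (r d : nat) : set (set divisor) :=
  [set divisor_class D | D in [set D | deg D = d%:Z /\ r%:Z <= rank D]].

Definition BN_rank (r d : nat) : int :=
  if `[< BN_locus r d !=set0 >] then
    largest [set rho | forall E, effective E -> deg E = r%:Z + rho ->
      exists D : divisor, [/\ deg D = d%:Z, r%:Z <= rank D & effective (D - E)]]
  else -1.

End MetricGraphTheory.

Section LoopOfLoops.

(* With indices i in Z/3, inl i is v_i and inr i is w_i; the edge inl i joins
   v_i to w_i, and the two edges inr (i, b) join w_i to v_(i+1). *)
Definition lol_vertex : finType := ('I_3 + 'I_3)%type.
Definition lol_edge : finType := ('I_3 + 'I_3 * bool)%type.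

Definition lol_src (e : lol_edge) : lol_vertex :=
  match e with inl i => inl i | inr (i, _) => inr i end.

Definition lol_tgt (e : lol_edge) : lol_vertex :=
  match e with inl i => inr i | inr (i, _) => inl (ordS i) end.

Lemma lol_vertex_gt0 : (0 < #|lol_vertex|)%N.
Proof. by rewrite card_sum card_ord. Qed.

Lemma lol_connected (u v : lol_vertex) :
  connect (fun x y => [exists e : lol_edge,
    ((lol_src e == x) && (lol_tgt e == y))
    || ((lol_src e == y) && (lol_tgt e == x))]) u v.
Proof.
set r := (X in connect X); pose zero : 'I_3 := ord0.
have rsym : connect_sym r.
  by apply: sym_connect_sym => x y; apply: eq_existsb => e; rewrite orbC.
have vw i : connect r (inl i) (inr i).
  by apply: connect1; apply/existsP; exists (inl i); rewrite !eqxx.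
have wv i : connect r (inr i) (inl (ordS i)).
  by apply: connect1; apply/existsP; exists (inr (i, true)); rewrite !eqxx.
have vv i : connect r (inl i) (inl (ordS i)) := connect_trans (vw i) (wv i).
have to_v i : connect r (inl zero) (inl i).
  have -> : i = iter i (@ordS 3) zero by case: i => [[|[|[|//]]] ?]; apply: val_inj.
  by elim: (nat_of_ord i) => // k /connect_trans; apply; apply: vv.
have to_any x : connect r (inl zero) x.
  by case: x => i //; apply: connect_trans (to_v i) (vw i).
by apply: connect_trans (to_any v); rewrite rsym.
Qed.

Definition loop_of_loops (R : realType) (l : lol_edge -> R)
    (l_gt0 : forall e, 0 < l e) : metricGraph R :=
  @MetricGraph R lol_vertex lol_edge lol_src lol_tgt l l_gt0
    lol_vertex_gt0 lol_connected.

End LoopOfLoops.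

(* Main.v *)
From mathcomp Require Import all_boot all_order all_algebra.
From mathcomp Require Import boolp classical_sets reals.
From mathcomp.multinomials Require Import freeg.
From mathcomp Require Import ring lra zify.
Require Import Defs.

Set Implicit Arguments.
Unset Strict Implicit.
Unset Printing Implicit Defensive.

Import Order.TTheory GRing.Theory Num.Theory.

Local Open Scope ring_scope.

(** Let a_i be the length of the edge v_i w_i.

    Lower bound: let a_i be maximal, j = i + 1, k = i + 2, and let b be the
    shorter of the two edges from w_j to v_k.  The divisor w_i + v_j + q, with
    q on the longer of these edges at distance min (max 0 (a_i - a_j - a_k)) b
    from v_k, has rank at least 1: a chip sliding along v_i w_i is always
    compensated by one chip moving on another edge v_m w_m, or by two chips
    crossing a loop together, and the chips thereby sweep the whole graph.

    Upper bound: let a_j be maximal, and let z and z' be the middles of one edge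
    of each of the two loops adjacent to the edge v_j w_j.  For every point x,
    Dhar's burning algorithm exhibits a point p such that no effective divisor
    equivalent to z + z' + x contains p.  The only delicate case is when z + x
    (or z' + x) is equivalent to w_i + v_j on its loop; maximality of a_j then
    stops the chip moving along v_j w_j from getting past the end of that edge. *)

(** * Piecewise linear functions on an interval *)

Section Slopes.
Variable R : realType.
Implicit Types (g : R -> R) (s : seq R) (m : int).

(** The relation from which [slope_right] selects with [xget]. Keeping it as a relation records that
    a slope exists, so that the default value 0 is never mistaken for one. *)
Definition right_slope g t m := exists2 eps : R, 0 < eps &
  forall h, 0 <= h <= eps -> g (t + h) = g t + m%:~R * h.

Definition left_slope g t m := exists2 eps : R, 0 < eps &
  forall h, 0 <= h <= eps -> g (t - h) = g t - m%:~R * h.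

Lemma right_slope_inj g t m m' :
  right_slope g t m -> right_slope g t m' -> m = m'.
Proof.
move=> [e e0 H] [e' e'0 H']; set d := Num.min e e'.
have d0 : 0 < d by rewrite lt_min e0.
have := H d; rewrite (H' d) ?ge_min ?lexx ?orbT ?(ltW d0)// => /(_ isT).
by move=> /addrI/(mulIf (lt0r_neq0 d0))/eqP; rewrite eqr_int => /eqP.
Qed.

Lemma left_slope_inj g t m m' : left_slope g t m -> left_slope g t m' -> m = m'.
Proof.
move=> [e e0 H] [e' e'0 H']; set d := Num.min e e'.
have d0 : 0 < d by rewrite lt_min e0.
have := H d; rewrite (H' d) ?ge_min ?lexx ?orbT ?(ltW d0)// => /(_ isT).
by move=> /addrI/oppr_inj/(mulIf (lt0r_neq0 d0))/eqP; rewrite eqr_int => /eqP.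
Qed.

Lemma slope_rightE g t m : right_slope g t m -> slope_right g t = m.
Proof. by move=> H; apply: xget_unique => // m' H'; apply: right_slope_inj H. Qed.

Lemma slope_leftE g t m : left_slope g t m -> slope_left g t = m.
Proof. by move=> H; apply: xget_unique => // m' H'; apply: left_slope_inj H. Qed.

Lemma right_slopeD g g' t m m' : right_slope g t m -> right_slope g' t m' ->
  right_slope (fun x => g x + g' x) t (m + m').
Proof.
move=> [e e0 H] [e' e'0 H']; exists (Num.min e e'); first by rewrite lt_min e0.
move=> h; rewrite le_min => /and3P[h0 he he'].
by rewrite H ?h0// H' ?h0// rmorphD/=; lra.
Qed.

Lemma left_slopeD g g' t m m' : left_slope g t m -> left_slope g' t m' ->
  left_slope (fun x => g x + g' x) t (m + m').
Proof.
move=> [e e0 H] [e' e'0 H']; exists (Num.min e e'); first by rewrite lt_min e0.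
move=> h; rewrite le_min => /and3P[h0 he he'].
by rewrite H ?h0// H' ?h0// rmorphD/=; lra.
Qed.

Lemma right_slopeN g t m : right_slope g t m -> right_slope (fun x => - g x) t (- m).
Proof. by move=> [e e0 H]; exists e => // h /H ->; rewrite rmorphN/=; lra. Qed.

Lemma left_slopeN g t m : left_slope g t m -> left_slope (fun x => - g x) t (- m).
Proof. by move=> [e e0 H]; exists e => // h /H ->; rewrite rmorphN/=; lra. Qed.

Lemma right_slope_cst c t : right_slope (fun=> c) t 0.
Proof. by exists 1 => // h _; lra. Qed.

Lemma left_slope_cst c t : left_slope (fun=> c) t 0.
Proof. by exists 1 => // h _; lra. Qed.

Lemma right_slope_reflect g t m :
  left_slope g t m -> right_slope (fun x => g (- x)) (- t) (- m).
Proof.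
by move=> [e e0 H]; exists e => // h /H; rewrite opprD !opprK rmorphN => ->/=; lra.
Qed.

Lemma left_slope_reflect g t m :
  right_slope g t m -> left_slope (fun x => g (- x)) (- t) (- m).
Proof.
move=> [e e0 H]; exists e => // h /H; rewrite (_ : - (- t - h) = t + h); last by lra.
by rewrite opprK rmorphN => ->/=; lra.
Qed.

Lemma eq_right_slope g g' t m (d : R) : t < d ->
  (forall x, t <= x <= d -> g x = g' x) -> right_slope g t m -> right_slope g' t m.
Proof.
move=> td E [e e0 H]; exists (Num.min e (d - t)); first by rewrite lt_min e0; lra.
move=> h; rewrite le_min => /and3P[h0 he hd].
by rewrite -!E ?H ?h0//; lra.
Qed.

Lemma eq_left_slope g g' t m (d : R) : d < t ->
  (forall x, d <= x <= t -> g x = g' x) -> left_slope g t m -> left_slope g' t m.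
Proof.
move=> td E [e e0 H]; exists (Num.min e (t - d)); first by rewrite lt_min e0; lra.
move=> h; rewrite le_min => /and3P[h0 he hd].
by rewrite -!E ?H ?h0//; lra.
Qed.

(** Let [c] be the supremum of the parameters up to which [P] holds. The left hypothesis gives
    [P c], and if [c < b] the right hypothesis pushes past [c]. *)
Lemma real_induction (a b : R) (P : R -> Prop) : a <= b -> P a ->
  (forall c, a <= c < b -> P c -> exists2 d, c < d & forall t, c < t <= d -> P t) ->
  (forall c, a < c <= b -> (forall t, a <= t < c -> P t) -> P c) ->
  forall t, a <= t <= b -> P t.
Proof.
move=> ab Pa Pr Pl.
pose A := [set c | a <= c <= b /\ forall t, a <= t <= c -> P t]%classic.
have Aa : A a.
  by split=> [|t]; [rewrite lexx | rewrite -eq_le => /eqP <-].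
have Ab : ubound A b by move=> c [/andP[]].
have hA : has_sup A by split; [exists a | exists b].
set c := sup A.
have ac : a <= c by apply: ub_le_sup Aa; exists b.
have cb : c <= b by apply: ge_sup => //; exists a.
have Pc' t : a <= t < c -> P t.
  move=> /andP[at_ tc]; have ct : 0 < c - t by lra.
  have [s [_ Hs] ts] := sup_adherent ct hA.
  by apply: Hs; rewrite at_ /= ltW//; move: ts; rewrite -/c; lra.
have Pc : P c.
  move: ac; rewrite le_eqVlt => /predU1P[<-//|ac]; apply: Pl => //; exact/andP.
have PcA t : a <= t <= c -> P t.
  by move=> /andP[at_]; rewrite le_eqVlt => /predU1P[->//|tc]; apply: Pc'; rewrite at_.
move=> t /andP[at_ tb]; move: cb; rewrite le_eqVlt => /predU1P[cb|cb].
  by apply: PcA; rewrite cb at_.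
have [|d cd Pd] := Pr c _ Pc; first by rewrite ac.
have: A (Num.min d b).
  split=> [|u /andP[au]]; first by rewrite le_min ge_min lexx orbT ab !andbT; lra.
  rewrite le_min => /andP[ud ub]; have [uc|cu] := leP u c; first by apply: PcA; rewrite au.
  by apply: Pd; rewrite cu.
move=> /(ub_le_sup (ex_intro _ b Ab)); rewrite ge_min -/c => /orP[]; lra.
Qed.

Lemma pl_on_extend g (t c : R) m : t = 0 \/ pl_on t g -> t < c ->
  (forall x, t <= x <= c -> g x = g t + m%:~R * (x - t)) -> pl_on c g.
Proof.
move=> [->|[s [ps ls Hs]]] tc H.
  exists [:: c]; split=> //=; first by rewrite tc.
  by case=> // _; exists m => /= x; exact: H.
exists (rcons s c); split; first by rewrite rcons_path ps ls.
  by rewrite last_rcons.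
move=> i; rewrite size_rcons ltnS leq_eqVlt => /predU1P[->|si].
  exists m => x; rewrite -rcons_cons !nth_rcons /= ltnn eqxx ltnSn.
  by rewrite -[size s]/(size (0 :: s)).-1 nth_last /= ls; exact: H.
by rewrite -rcons_cons !nth_rcons /= si ltnW//; exact: Hs.
Qed.

(** A local criterion: real induction glues the affine germs into a finite subdivision. Sums and
    negatives can then be handled without common refinements. *)
Lemma slopes_pl_on g l : 0 < l ->
  (forall t, 0 <= t < l -> exists m, right_slope g t m) ->
  (forall t, 0 < t <= l -> exists m, left_slope g t m) -> pl_on l g.
Proof.
move=> l0 Hr Hl; pose P t := t = 0 \/ pl_on t g.
suff : P l by case=> // E; move: l0; rewrite E ltxx.
apply: (@real_induction 0 l P); rewrite ?lexx ?(ltW l0)//; first by left.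
- move=> c cl Pc; have [m [e e0 H]] := Hr c cl.
  exists (c + e); first by lra.
  move=> t /andP[ct te]; right; apply: (pl_on_extend (m := m) Pc) => // x /andP[cx xt].
  by rewrite -H; [congr g|]; lra.
- move=> c cl Pc; have [m [e e0 H]] := Hl c cl.
  case/andP: (cl) => c0 _.
  have tc : Num.max 0 (c - e) < c by rewrite gt_max c0/=; lra.
  right; apply: (pl_on_extend (m := m) (Pc _ _) tc).
    by rewrite tc le_max lexx.
  have te : c - e <= Num.max 0 (c - e) by rewrite le_max lexx orbT.
  move: (Num.max _ _) tc te => t tc te x /andP[tx xc].
  rewrite (_ : x = c - (c - x)); last by lra.
  rewrite H; last by lra.
  rewrite (_ : g t = g (c - (c - t))); last by congr g; lra.
  by rewrite H; lra.
Qed.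

(** The left endpoint varies here, unlike in [pl_on], so that a subdivision can be consumed from its
    first piece on. *)
Definition pl_from (a b : R) g := exists s,
  [/\ path <%R a s, last a s = b & forall i, (i < size s)%N ->
        exists m, forall t, nth 0 (a :: s) i <= t <= nth 0 s i ->
          g t = g (nth 0 (a :: s) i) + m%:~R * (t - nth 0 (a :: s) i)].

Lemma pl_from_ind (P : R -> R -> Prop) g :
  (forall a, P a a) ->
  (forall a b c m, a < b -> b <= c ->
    (forall t, a <= t <= b -> g t = g a + m%:~R * (t - a)) -> P b c -> P a c) ->
  forall a b, pl_from a b g -> P a b.
Proof.
move=> P0 PS a b [s []]; elim: s a => [a _ <- _|c s IH a /=]; first exact: P0.
move=> /andP[ac ps] ls H; have [m Hm] := H 0%N isT.
apply: PS (ac) _ Hm _.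
  have := order_path_min lt_trans ps => /allP cs; rewrite -ls.
  have := mem_last c s; rewrite inE => /predU1P[->//|/cs/ltW//].
by apply: IH => // i si; have [k Hk] := H i.+1 si; exists k.
Qed.

Lemma affine_right_slope g a b m t :
  (forall t, a <= t <= b -> g t = g a + m%:~R * (t - a)) -> a <= t < b ->
  right_slope g t m.
Proof.
move=> H /andP[at_ tb]; exists (b - t); first lra.
by move=> h /andP[h0 hb]; rewrite (H (t + h)) ?(H t); lra.
Qed.

Lemma affine_left_slope g a b m t :
  (forall t, a <= t <= b -> g t = g a + m%:~R * (t - a)) -> a < t <= b ->
  left_slope g t m.
Proof.
move=> H /andP[at_ tb]; exists (t - a); first lra.
by move=> h /andP[h0 hb]; rewrite (H (t - h)) ?(H t); lra.
Qed.

Lemma pl_on_right_slope g l t : pl_on l g -> 0 <= t < l -> exists m, right_slope g t m.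
Proof.
pose P a b := a <= t < b -> exists m, right_slope g t m.
apply: (@pl_from_ind P) => [a|a b c m ab bc H IH]; first by rewrite /P; lra.
move=> /andP[at_ tc]; have [bt|tb] := leP b t; first by apply: IH; rewrite bt.
by exists m; apply: affine_right_slope H _; rewrite at_.
Qed.

Lemma pl_on_left_slope g l t : pl_on l g -> 0 < t <= l -> exists m, left_slope g t m.
Proof.
pose P a b := a < t <= b -> exists m, left_slope g t m.
apply: (@pl_from_ind P) => [a|a b c m ab bc H IH]; first by rewrite /P; lra.
move=> /andP[at_ tc]; have [tb|bt] := leP t b; last by apply: IH; rewrite bt.
by exists m; apply: affine_left_slope H _; rewrite at_.
Qed.

Lemma pl_on_min g l : 0 <= l -> pl_on l g ->
  exists2 t0, 0 <= t0 <= l & forall t, 0 <= t <= l -> g t0 <= g t.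
Proof.
pose P a b := a <= b -> exists2 t0, a <= t0 <= b & forall t, a <= t <= b -> g t0 <= g t.
move=> l0 Hg; move: l0; apply: (@pl_from_ind P g _ _ 0 l Hg) => [a _|a b c m ab bc H IH _].
  by exists a; rewrite ?lexx// => t; rewrite -eq_le => /eqP <-.
have [t0 /andP[bt0 t0c] Ht0] := IH bc.
have Hb : g b = g a + m%:~R * (b - a) by apply: H; lra.
have [ga|ga] := leP (g a) (g t0).
  exists a => [|t /andP[at_ tc]]; first lra.
  have [bt|tb] := leP b t; first by apply: le_trans ga (Ht0 _ _); rewrite bt.
  rewrite (H t); last by rewrite at_ ltW.
  rewrite lerDl; apply: mulr_ge0; last lra.
  have gb : g a <= g b by apply: le_trans ga (Ht0 _ _); rewrite lexx.
  rewrite Hb lerDl pmulr_lge0// in gb; lra.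
exists t0 => [|t /andP[at_ tc]]; first lra.
have [bt|tb] := leP b t; first by apply: Ht0; rewrite bt.
have gb : g t0 <= g b by apply: Ht0; rewrite lexx.
rewrite (H t); last by rewrite at_ ltW.
have [m0|m0] := leP 0 (m%:~R : R).
  by apply: le_trans (ltW ga) _; rewrite lerDl mulr_ge0//; lra.
rewrite Hb in gb; apply: le_trans gb _; rewrite lerD2l ler_nM2l//; lra.
Qed.

Lemma right_slope_ge0 g t m (d : R) : t < d ->
  (forall x, t <= x <= d -> g t <= g x) -> right_slope g t m -> 0 <= m.
Proof.
move=> td gt [e e0 H]; set h := Num.min e (d - t).
have h0 : 0 < h by rewrite lt_min e0; lra.
have he : h <= e by rewrite ge_min lexx.
have hd : h <= d - t by rewrite ge_min lexx orbT.
have : g t <= g (t + h) by apply: gt; lra.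
by rewrite H ?(ltW h0)// lerDl pmulr_lge0// ler0z.
Qed.

Lemma left_slope_le0 g t m (d : R) : d < t ->
  (forall x, d <= x <= t -> g t <= g x) -> left_slope g t m -> m <= 0.
Proof.
move=> dt gt /right_slope_reflect/right_slope_ge0 H.
rewrite -oppr_ge0; apply: (H (- d)) => [|x xt]; first by rewrite ltrN2.
by rewrite opprK; apply: gt; lra.
Qed.

(** At a point where the minimum is attained the left slope is at most 0 and the right slope at
    least 0; concavity forces both to vanish, so the minimum persists to the right. This is the
    analytic core of the burning argument. *)
Lemma min_spread_right g a b : a <= b ->
  (forall t, a <= t <= b -> g a <= g t) ->
  (forall t, a <= t < b -> exists m, right_slope g t m) ->
  (forall t, a < t <= b -> exists m, left_slope g t m) ->
  (forall t m m', a < t < b -> left_slope g t m -> right_slope g t m' -> m' <= m) ->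
  (a < b -> right_slope g a 0) ->
  forall t, a <= t <= b -> g t = g a.
Proof.
move=> ab ga Hr Hl Hlr ra; apply: real_induction => // c /[dup] cb /andP[ac bc].
- move=> gc; have [m rm] := Hr c cb.
  have rc : right_slope g c 0.
    move: ac; rewrite le_eqVlt => /predU1P[<-|ac]; first by apply: ra; lra.
    have [n ln] := Hl c ltac:(lra).
    have n0 : n <= 0 by apply: left_slope_le0 ac _ ln => x xc; rewrite gc ga//; lra.
    have m0 : 0 <= m by apply: right_slope_ge0 bc _ rm => x xc; rewrite gc ga//; lra.
    have mn := Hlr c m n; suff <- : m = 0 by [].
    by have := Hlr c _ _ ltac:(lra) ln rm; lia.
  case: rc => e e0 H; exists (c + e); first by lra.
  by move=> t te; rewrite -gc -[t](subrKC c) H; [rewrite mul0r addr0|lra].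
- move=> gt; have [m [e e0 H]] := Hl c cb.
  set h := Num.min e (c - a).
  have h0 : 0 < h by rewrite lt_min e0; lra.
  have he : h <= e by rewrite ge_min lexx.
  have hc : h <= c - a by rewrite ge_min lexx orbT.
  (* Two points to the left of [c] with value [g a] force the affine germ at [c] to be constant. *)
  have H1 := H h ltac:(lra); have H2 := H (h / 2) ltac:(lra).
  by rewrite (gt (c - h)) in H1; [rewrite (gt (c - h / 2)) in H2; lra | lra].
Qed.

Lemma min_spread_left g a b : a <= b ->
  (forall t, a <= t <= b -> g b <= g t) ->
  (forall t, a <= t < b -> exists m, right_slope g t m) ->
  (forall t, a < t <= b -> exists m, left_slope g t m) ->
  (forall t m m', a < t < b -> left_slope g t m -> right_slope g t m' -> m' <= m) ->
  (a < b -> left_slope g b 0) ->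
  forall t, a <= t <= b -> g t = g b.
Proof.
move=> ab gb Hr Hl Hlr lb t tab.
have := @min_spread_right (fun x => g (- x)) (- b) (- a); rewrite !opprK => S.
rewrite -[t]opprK; apply: (S); rewrite ?lerN2//.
- by move=> x xab; apply: gb; lra.
- move=> x xab; have [m /right_slope_reflect] := Hl (- x) ltac:(lra).
  by rewrite opprK; exists (- m).
- move=> x xab; have [m /left_slope_reflect] := Hr (- x) ltac:(lra).
  by rewrite opprK; exists (- m).
- move=> x m m' xab lm rm; rewrite -lerN2; apply: (Hlr (- x)); first lra.
    have /left_slope_reflect := rm.
    apply: eq_left_slope (_ : - x - 1 < - x) _ => [|y _]; first lra.
    by rewrite opprK.
  have /right_slope_reflect := lm.
  apply: eq_right_slope (_ : - x < - x + 1) _ => [|y _]; first lra.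
  by rewrite opprK.
- by rewrite ltrN2 => /lb /right_slope_reflect; rewrite oppr0.
- lra.
Qed.

End Slopes.

(** * Principal divisors *)

Section MetricGraph.
Variables (R : realType) (G : metricGraph R).
Implicit Types (e : edge G) (v : vertex G) (p q : point G) (f : point G -> R) (D : divisor G).

Lemma coeff_point p q : coeff q (<< p >> : divisor G) = (p == q)%:Z.
Proof. by rewrite coeffU mul1r natz. Qed.

Lemma epoint_val e t : 0 < t < len e -> val (epoint e t) = inr (e, t).
Proof. by move=> te; rewrite /epoint val_insubd /= te. Qed.

Lemma epoint_src e t : t <= 0 -> epoint e t = vpoint (src e).
Proof.
move=> t0; apply: val_inj; rewrite /epoint val_insubd /= t0.
by rewrite ltNge t0.
Qed.

Lemma epoint_tgt e t : len e <= t -> epoint e t = vpoint (tgt e).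
Proof.
have l0 := len_gt0 e => lt; apply: val_inj; rewrite /epoint val_insubd /= ltNge.
by rewrite [t < _]ltNge lt andbF leNgt (lt_le_trans l0 lt).
Qed.

Variant point_spec : point G -> Type :=
| PointVertex v : point_spec (vpoint v)
| PointEdge e t of 0 < t < len e : point_spec (epoint e t).

Lemma pointP p : point_spec p.
Proof.
case: p => [[v|[e t]] pp].
  by rewrite (_ : exist _ _ _ = vpoint v); [constructor | apply: val_inj].
rewrite (_ : exist _ _ _ = epoint e t); first by constructor.
by apply: val_inj; rewrite epoint_val.
Qed.

(** The indicator is expressed through the comparisons that give the slopes of the hinge functions
    below, so that coefficients and orders match algebraically. [epoint_eq_edge] does the same for
    interior points. *)
Lemma epoint_eq_vertex e t v : 0 <= t <= len e ->
  ((epoint e t == vpoint v)%R%:Z =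
   (tgt e == v)%R%:Z * (1 - (t < len e)%R%:Z) + (src e == v)%R%:Z * (t <= 0)%R%:Z)%R.
Proof.
have l0 := len_gt0 e; move=> /andP[t0 tl].
have [t0'|t0'] := leP t 0.
  rewrite epoint_src// (le_lt_trans t0' l0) -val_eqE /=.
  by rewrite -[inl _ == _]/(src e == v); lia.
have [tl'|tl'] := ltP t (len e); last first.
  by rewrite epoint_tgt// -val_eqE /= -[inl _ == _]/(tgt e == v); lia.
by rewrite -val_eqE epoint_val ?t0'//=; lia.
Qed.

Lemma epoint_eq_edge e e' t t' : 0 <= t <= len e -> 0 < t' < len e' ->
  ((epoint e t == epoint e' t')%R%:Z = (e == e')%R%:Z * ((t <= t')%R%:Z - (t < t')%R%:Z))%R.
Proof.
have l0 := len_gt0 e; move=> /andP[t0 tl] /[dup] te' /andP[t'0 t'l].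
rewrite -val_eqE (epoint_val te').
have [t0'|t0'] := leP t 0.
  rewrite epoint_src// (le_trans t0' (ltW t'0)) (le_lt_trans t0' t'0).
  by rewrite subrr mulr0.
have [tl'|tl'] := ltP t (len e); last first.
  rewrite epoint_tgt// (_ : (_ == inr _) = false)//.
  have [ee|_] := eqVneq e e'; last by rewrite mul0r.
  have t'e : t' < t by rewrite -ee in t'l; exact: lt_le_trans t'l tl'.
  by rewrite leNgt t'e ltNge (ltW t'e).
rewrite epoint_val ?t0'// -[inr _ == _]/((e, t) == (e', t')) xpair_eqE.
by case: (e == e') => //=; case: ltgtP.
Qed.

Lemma pl_right_slope f e t : piecewise_linear f -> 0 <= t < len e ->
  right_slope (f \o epoint e) t (slope_right (f \o epoint e) t).
Proof. by move=> /(_ e)/pl_on_right_slope H /H[m Hm]; rewrite (slope_rightE Hm). Qed.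

Lemma pl_left_slope f e t : piecewise_linear f -> 0 < t <= len e ->
  left_slope (f \o epoint e) t (slope_left (f \o epoint e) t).
Proof. by move=> /(_ e)/pl_on_left_slope H /H[m Hm]; rewrite (slope_leftE Hm). Qed.

Lemma ord_at_edge f e t : 0 < t < len e ->
  ord_at f (epoint e t) = slope_left (f \o epoint e) t - slope_right (f \o epoint e) t.
Proof. by move=> te; rewrite /ord_at epoint_val. Qed.

Lemma piecewise_linearD f f' : piecewise_linear f -> piecewise_linear f' ->
  piecewise_linear (fun p => f p + f' p).
Proof.
move=> Hf Hf' e; apply: slopes_pl_on => [|t te|t te]; first exact: len_gt0.
  by eexists; apply: right_slopeD; apply: pl_right_slope.
by eexists; apply: left_slopeD; apply: pl_left_slope.
Qed.

Lemma piecewise_linearN f : piecewise_linear f -> piecewise_linear (fun p => - f p).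
Proof.
move=> Hf e; apply: slopes_pl_on => [|t te|t te]; first exact: len_gt0.
  by eexists; apply: right_slopeN; apply: pl_right_slope.
by eexists; apply: left_slopeN; apply: pl_left_slope.
Qed.

Lemma ord_atD f f' p : piecewise_linear f -> piecewise_linear f' ->
  ord_at (fun p => f p + f' p) p = ord_at f p + ord_at f' p.
Proof.
move=> Hf Hf'.
have rD e t : 0 <= t < len e -> slope_right ((fun p => f p + f' p) \o epoint e) t =
    slope_right (f \o epoint e) t + slope_right (f' \o epoint e) t.
  by move=> te; apply: slope_rightE; apply: right_slopeD; apply: pl_right_slope.
have lD e t : 0 < t <= len e -> slope_left ((fun p => f p + f' p) \o epoint e) t =
    slope_left (f \o epoint e) t + slope_left (f' \o epoint e) t.
  by move=> te; apply: slope_leftE; apply: left_slopeD; apply: pl_left_slope.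
case: p / pointP => [v|e t te]; last first.
  by rewrite !ord_at_edge// rD ?lD; [ring | lra | lra].
rewrite /ord_at /= addrACA -opprD -!big_split /=; congr (_ - _).
  by apply: eq_bigr => e _; rewrite lD// len_gt0 lexx.
by apply: eq_bigr => e _; rewrite rD// len_gt0 lexx.
Qed.

Lemma ord_atN f p : piecewise_linear f -> ord_at (fun p => - f p) p = - ord_at f p.
Proof.
move=> Hf.
have rN e t : 0 <= t < len e ->
    slope_right ((fun p => - f p) \o epoint e) t = - slope_right (f \o epoint e) t.
  by move=> te; apply: slope_rightE; apply: right_slopeN; apply: pl_right_slope.
have lN e t : 0 < t <= len e ->
    slope_left ((fun p => - f p) \o epoint e) t = - slope_left (f \o epoint e) t.
  by move=> te; apply: slope_leftE; apply: left_slopeN; apply: pl_left_slope.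
case: p / pointP => [v|e t te]; last first.
  by rewrite !ord_at_edge// rN ?lN; [ring | lra | lra].
rewrite /ord_at /= opprD -!sumrN; congr (_ + _).
  by apply: eq_bigr => e _; rewrite lN// len_gt0 lexx.
by apply: eq_bigr => e _; rewrite rN// len_gt0 lexx.
Qed.

Lemma principalN D : principal D -> principal (- D).
Proof.
move=> [f Hf Df]; exists (fun p => - f p); first exact: piecewise_linearN.
by move=> p; rewrite coeffN Df ord_atN.
Qed.

Lemma principalD D D' : principal D -> principal D' -> principal (D + D').
Proof.
move=> [f Hf Df] [f' Hf' Df']; exists (fun p => f p + f' p).
  exact: piecewise_linearD.
by move=> p; rewrite coeffD Df Df' ord_atD.
Qed.

Lemma principal0 : principal (0 : divisor G).
Proof.
exists (fun=> 0) => [e|p].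
  apply: slopes_pl_on => [|t _|t _]; first exact: len_gt0.
    by exists 0; apply: right_slope_cst.
  by exists 0; apply: left_slope_cst.
have r0 e t : slope_right ((fun=> 0 : R) \o epoint e) t = 0.
  by apply: slope_rightE; apply: right_slope_cst.
have l0 e t : slope_left ((fun=> 0 : R) \o epoint e) t = 0.
  by apply: slope_leftE; apply: left_slope_cst.
case: p / pointP => [v|e t te]; rewrite coeff0.
  by rewrite /ord_at /= !big1 ?subrr.
by rewrite ord_at_edge// r0 l0 subrr.
Qed.

Lemma equivalent_refl D : equivalent D D.
Proof. by rewrite /equivalent subrr; exact: principal0. Qed.

Lemma equivalent_sym D D' : equivalent D D' -> equivalent D' D.
Proof. by move=> /principalN; rewrite opprB. Qed.

Lemma equivalent_trans D D' D'' :
  equivalent D D' -> equivalent D' D'' -> equivalent D D''.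
Proof. by move=> H H'; have := principalD H H'; rewrite addrA subrK. Qed.

Lemma equivalentDr D D' E : equivalent D D' -> equivalent (D + E) (D' + E).
Proof. by rewrite /equivalent opprD addrACA subrr addr0. Qed.

(** * Equivalences obtained by moving chips along edges *)

Section Moves.
(** An entry [(e, (s, t))] moves a chip on [e] from parameter [s] to [t]. The map [g] prescribes the
    potential at the vertices; [ms_g] says that along each edge it increases by the total signed
    displacement. *)
Variables (ms : seq (edge G * (R * R))) (g : vertex G -> R).
Hypothesis ms_in : {in ms, forall m, (0 <= m.2.1 <= len m.1) && (0 <= m.2.2 <= len m.1)}.
Hypothesis ms_g : forall e,
  \sum_(m <- ms | m.1 == e) (m.2.2 - m.2.1) = g (tgt e) - g (src e).

Let hinge (s t : R) : R := Num.max (t - s) 0.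

Let right_slope_hinge s t : right_slope (hinge s) t (s <= t)%R%:Z.
Proof.
rewrite /hinge; have [st|ts] := leP s t.
  by exists 1 => // h h01; rewrite mulr1z mul1r !max_l; lra.
by exists (s - t) => [|h h01]; [lra | rewrite mulr0z mul0r !max_r; lra].
Qed.

Let left_slope_hinge s t : left_slope (hinge s) t (s < t)%R%:Z.
Proof.
rewrite /hinge; have [st|ts] := ltP s t.
  by exists (t - s) => [|h h01]; [lra | rewrite mulr1z mul1r !max_l; lra].
by exists 1 => // h h01; rewrite mulr0z mul0r !max_r; lra.
Qed.

(** A move from [s] to [s'] contributes a function of slope 1 between them (or -1 if [s' < s]) and 0
    elsewhere; its divisor is the new position minus the old one. *)
Let F e t := g (src e) + \sum_(m <- ms | m.1 == e) (hinge m.2.1 t - hinge m.2.2 t).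

Let right_slope_F e t : right_slope (F e) t
  (\sum_(m <- ms | m.1 == e) ((m.2.1 <= t)%R%:Z - (m.2.2 <= t)%R%:Z)).
Proof.
rewrite -[X in right_slope _ _ X]add0r.
apply: right_slopeD; first exact: right_slope_cst.
elim: ms => [|m s IH].
  by under eq_fun do rewrite big_nil; rewrite big_nil; exact: right_slope_cst.
under eq_fun do rewrite big_cons; rewrite big_cons; case: ifP => // _.
apply: right_slopeD => //; apply: right_slopeD; first exact: right_slope_hinge.
exact/right_slopeN/right_slope_hinge.
Qed.

Let left_slope_F e t : left_slope (F e) t
  (\sum_(m <- ms | m.1 == e) ((m.2.1 < t)%R%:Z - (m.2.2 < t)%R%:Z)).
Proof.
rewrite -[X in left_slope _ _ X]add0r.
apply: left_slopeD; first exact: left_slope_cst.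
elim: ms => [|m s IH].
  by under eq_fun do rewrite big_nil; rewrite big_nil; exact: left_slope_cst.
under eq_fun do rewrite big_cons; rewrite big_cons; case: ifP => // _.
apply: left_slopeD => //; apply: left_slopeD; first exact: left_slope_hinge.
exact/left_slopeN/left_slope_hinge.
Qed.

Let F0 e : F e 0 = g (src e).
Proof.
rewrite /F big_seq_cond big1 ?addr0// => m /andP[/ms_in mi _].
by rewrite /hinge !max_r; lra.
Qed.

Let Fl e : F e (len e) = g (tgt e).
Proof.
rewrite -[RHS](subrKC (g (src e))) -ms_g /F; congr (_ + _).
rewrite big_seq_cond [RHS]big_seq_cond; apply: eq_bigr => m /andP[/ms_in mi /eqP <-].
by rewrite /hinge !max_l; lra.
Qed.

Let f p := match val p with inl v => g v | inr (e, t) => F e t end.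

Let f_epoint e t : 0 <= t <= len e -> F e t = (f \o epoint e) t.
Proof.
move=> /andP[t0 tl] /=.
have [t0'|t0'] := leP t 0; first by rewrite epoint_src// /f /= -F0; congr F; lra.
have [tl'|tl'] := ltP t (len e); last by rewrite epoint_tgt// /f /= -Fl; congr F; lra.
by rewrite /f epoint_val ?t0'.
Qed.

Let right_slope_f e t : 0 <= t < len e -> right_slope (f \o epoint e) t
  (\sum_(m <- ms | m.1 == e) ((m.2.1 <= t)%R%:Z - (m.2.2 <= t)%R%:Z)).
Proof.
move=> te; apply: (@eq_right_slope _ (F e) _ _ _ (len e)); first lra.
  by move=> x xt; apply: f_epoint; lra.
exact: right_slope_F.
Qed.

Let left_slope_f e t : 0 < t <= len e -> left_slope (f \o epoint e) t
  (\sum_(m <- ms | m.1 == e) ((m.2.1 < t)%R%:Z - (m.2.2 < t)%R%:Z)).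
Proof.
move=> te; apply: (@eq_left_slope _ (F e) _ _ _ 0); first lra.
  by move=> x xt; apply: f_epoint; lra.
exact: left_slope_F.
Qed.

Lemma moves_equivalent : equivalent
  (\sum_(m <- ms) << epoint m.1 m.2.2 >>) (\sum_(m <- ms) << epoint m.1 m.2.1 >>).
Proof.
exists f => [e|p].
  apply: slopes_pl_on => [|t te|t te]; first exact: len_gt0.
    by eexists; exact: right_slope_f.
  by eexists; exact: left_slope_f.
have -> : coeff p (\sum_(m <- ms) << epoint m.1 m.2.2 >> -
                   \sum_(m <- ms) << epoint m.1 m.2.1 >>)
    = \sum_(m <- ms) ((epoint m.1 m.2.2 == p)%:Z - (epoint m.1 m.2.1 == p)%:Z).
  rewrite sumrB coeffB !(raddf_sum (coeff p)).
  by congr (_ - _); apply: eq_bigr => m _; exact: coeff_point.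
case: p / pointP => [v|e t te]; last first.
  rewrite ord_at_edge// (slope_leftE (left_slope_f _)); last lra.
  rewrite (slope_rightE (right_slope_f _)); last lra.
  rewrite -sumrB [RHS]big_mkcond /= big_seq [RHS]big_seq.
  apply: eq_bigr => m /ms_in/andP[m1 m2].
  by rewrite !epoint_eq_edge//; case: eqP => _ /=; ring.
rewrite /ord_at /=.
under [X in _ = X - _]eq_bigr => e _.
  rewrite (slope_leftE (left_slope_f _)); last by rewrite len_gt0 lexx.
  rewrite big_mkcond; over.
under [X in _ = _ - X]eq_bigr => e _.
  rewrite (slope_rightE (right_slope_f _)); last by rewrite len_gt0 lexx.
  rewrite big_mkcond; over.
(* With the sum over moves outside, each move contributes only through its own edge. *)
rewrite exchange_big [X in _ = _ - X]exchange_big /= -sumrB.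
rewrite big_seq [RHS]big_seq; apply: eq_bigr => m /ms_in/andP[m1 m2].
have sum1 (P : pred (edge G)) (c : edge G -> int) :
    \sum_(e | P e) (if m.1 == e then c e else 0) = if P m.1 then c m.1 else 0.
  rewrite big_mkcond (bigD1 m.1)//= eqxx big1 ?addr0// => e /negPf em.
  by rewrite eq_sym em if_same.
by rewrite !sum1 !epoint_eq_vertex//; do 2 case: eqP => _ /=; ring.
Qed.

End Moves.

End MetricGraph.

(** * Burning *)

Section Dhar.
Variables (R : realType) (G : metricGraph R).
Implicit Types (e : edge G) (v : vertex G) (p q : point G) (f : point G -> R) (D : divisor G)
  (h : edge G * bool).

(** A pair [(e, b)] is a half-edge, with [true] for the source side; a loop thus yields two
    half-edges at its vertex. *)
Definition endv h : vertex G := if h.2 then src h.1 else tgt h.1.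

Definition outgoing_slope f h : int :=
  if h.2 then slope_right (f \o epoint h.1) 0
  else - slope_left (f \o epoint h.1) (len h.1).

Lemma ord_at_vertex f v :
  ord_at f (vpoint v) = - \sum_(h | endv h == v) outgoing_slope f h.
Proof.
rewrite [in RHS]big_mkcond -(pair_bigA_idem _ (fun e b =>
  if endv (e, b) == v then outgoing_slope f (e, b) else 0)) ?addr0//=.
under [in RHS]eq_bigr do rewrite big_bool.
rewrite big_split /= opprD addrC /ord_at /= -!big_mkcond/=.
by rewrite /outgoing_slope /= sumrN opprK.
Qed.

Lemma piecewise_linear_min f : (0 < #|vertex G|)%N -> piecewise_linear f ->
  exists q, forall p, f q <= f p.
Proof.
move=> /card_gt0P[v0 _] Hf.
have /choice[t Ht] : forall e, exists t0, 0 <= t0 <= len e /\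
    forall t, 0 <= t <= len e -> f (epoint e t0) <= f (epoint e t).
  move=> e; have [t0 t0l H] := pl_on_min (ltW (len_gt0 e)) (Hf e).
  by exists t0; split=> // t /H.
(* Finitely many candidates suffice: the vertices and one minimizer on each edge. *)
pose P (x : vertex G + edge G) := match x with inl v => vpoint v | inr e => epoint e (t e) end.
case: (@arg_minP _ _ _ (inl v0) xpredT (f \o P)) => // x _ Hx.
exists (P x) => p; case: p / pointP => [v|e s se]; first exact: (Hx (inl v)).
by apply: le_trans (Hx (inr e) isT) _; apply: (Ht e).2; lra.
Qed.

Section Burning.
Variables (f : point G -> R) (q0 : point G).
Hypotheses (Hf : piecewise_linear f) (Hq0 : forall p, f q0 <= f p).

Let at_min p := f p = f q0.

Let right_ge0 e t : 0 <= t < len e -> at_min (epoint e t) ->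
  0 <= slope_right (f \o epoint e) t.
Proof.
move=> te mt; apply: (right_slope_ge0 (d := len e)) (pl_right_slope Hf te); first lra.
by move=> x xt /=; rewrite mt.
Qed.

Let left_le0 e t : 0 < t <= len e -> at_min (epoint e t) ->
  slope_left (f \o epoint e) t <= 0.
Proof.
move=> te mt; apply: (left_slope_le0 (d := 0)) (pl_left_slope Hf te); first lra.
by move=> x xt /=; rewrite mt.
Qed.

Let spread_right e (a b : R) : 0 <= a -> a <= b -> b <= len e -> at_min (epoint e a) ->
  (forall t, a < t < b -> 0 <= ord_at f (epoint e t)) ->
  (a < b -> slope_right (f \o epoint e) a = 0) ->
  forall t, a <= t <= b -> at_min (epoint e t).
Proof.
move=> a0 ab bl ma ot ra t tab; rewrite /at_min -ma.
apply: (@min_spread_right _ (f \o epoint e) a b) => //.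
- by move=> x _ /=; rewrite ma.
- by move=> x xab; eexists; apply: pl_right_slope Hf _; lra.
- by move=> x xab; eexists; apply: pl_left_slope Hf _; lra.
- move=> x m m' xab /slope_leftE <- /slope_rightE <-.
  by rewrite -subr_ge0 -ord_at_edge ?ot//; lra.
- by move=> lab; rewrite -(ra lab); apply: pl_right_slope Hf _; lra.
Qed.

Let spread_left e (a b : R) : 0 <= a -> a <= b -> b <= len e -> at_min (epoint e b) ->
  (forall t, a < t < b -> 0 <= ord_at f (epoint e t)) ->
  (a < b -> slope_left (f \o epoint e) b = 0) ->
  forall t, a <= t <= b -> at_min (epoint e t).
Proof.
move=> a0 ab bl mb ot lb t tab; rewrite /at_min -mb.
apply: (@min_spread_left _ (f \o epoint e) a b) => //.
- by move=> x _ /=; rewrite mb.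
- by move=> x xab; eexists; apply: pl_right_slope Hf _; lra.
- by move=> x xab; eexists; apply: pl_left_slope Hf _; lra.
- move=> x m m' xab /slope_leftE <- /slope_rightE <-.
  by rewrite -subr_ge0 -ord_at_edge ?ot//; lra.
- by move=> lab; rewrite -(lb lab); apply: pl_left_slope Hf _; lra.
Qed.

Lemma outgoing_slope_ge0 h : at_min (vpoint (endv h)) -> 0 <= outgoing_slope f h.
Proof.
have l0 := len_gt0 h.1; rewrite /endv /outgoing_slope; case: h.2 => mh.
  by apply: right_ge0; rewrite ?epoint_src// lexx.
by rewrite oppr_ge0; apply: left_le0; rewrite ?epoint_tgt// lexx andbT.
Qed.

(** If the slope vanished, the minimum would spread along the whole edge; being a nonnegative
    integer, it is therefore at least 1. *)
Lemma outgoing_slope_gt0 h t :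
  (forall s, 0 < s < len h.1 -> 0 <= ord_at f (epoint h.1 s)) ->
  0 <= t <= len h.1 -> at_min (vpoint (endv h)) -> ~ at_min (epoint h.1 t) ->
  1 <= outgoing_slope f h.
Proof.
move=> oh th mh nt; rewrite -gtz0_ge1 lt_neqAle outgoing_slope_ge0// andbT.
have l0 := len_gt0 h.1.
apply/eqP => o0; apply: nt; move: mh o0; rewrite /endv /outgoing_slope.
case: h.2 => mh o0.
  by apply: (@spread_right _ 0 (len h.1)); rewrite ?epoint_src ?lexx ?(ltW l0).
apply: (@spread_left _ 0 (len h.1)); rewrite ?epoint_tgt ?lexx ?(ltW l0)// => _.
by apply/eqP; rewrite -oppr_eq0 -o0.
Qed.

(** At an interior minimum an order of at least -1 makes one of the two slopes vanish. The minimum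
    then spreads to an end of the edge, in a direction avoiding the exceptional point [t1]. *)
Lemma min_at_vertex : (forall e, exists t1,
    (0 < t1 < len e -> -1 <= ord_at f (epoint e t1)) /\
    forall t, 0 < t < len e -> t != t1 -> 0 <= ord_at f (epoint e t)) ->
  exists v, at_min (vpoint v).
Proof.
move=> H; have : at_min q0 by [].
case: {1}q0 / pointP => [v mv|e t te mt]; first by exists v.
have [t1 [ot1 ot]] := H e.
have r0 : 0 <= slope_right (f \o epoint e) t by apply: right_ge0 => //; lra.
have l0 : slope_left (f \o epoint e) t <= 0 by apply: left_le0 => //; lra.
have /andP[t_0 t_l] := te.
have go_right : t1 <= t -> slope_right (f \o epoint e) t = 0 -> exists v, at_min (vpoint v).
  move=> t1t rt; exists (tgt e); rewrite -(@epoint_tgt _ _ e (len e))//.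
  apply: (@spread_right e t (len e)); rewrite ?lexx ?(ltW t_l) ?(ltW t_0)// => x xt.
  by apply: ot; [lra | rewrite gt_eqF//; lra].
have go_left : t <= t1 -> slope_left (f \o epoint e) t = 0 -> exists v, at_min (vpoint v).
  move=> t1t rt; exists (src e); rewrite -(@epoint_src _ _ e 0)//.
  apply: (@spread_left e 0 t); rewrite ?lexx ?(ltW t_l) ?(ltW t_0)// => x xt.
  by apply: ot; [lra | rewrite lt_eqF//; lra].
case: (eqVneq t t1) => [tt1|nt].
  have := ot1; rewrite -tt1 => /(_ te); rewrite ord_at_edge// => o.
  have : (slope_right (f \o epoint e) t == 0) || (slope_left (f \o epoint e) t == 0) by lia.
  by case/orP => /eqP; [apply: go_right | apply: go_left]; rewrite tt1.
have := ot t te nt; rewrite ord_at_edge// => o.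
have [tt1|t1t] := leP t t1; first by apply: go_left => //; lia.
by apply: go_right (ltW t1t) _; lia.
Qed.

End Burning.

(* Dhar's burning algorithm: [S] is the set of unburnt vertices when the fire
   starts at the point [tp] of [ep]; a vertex with fewer chips than burning
   edges burns. *)
Lemma burning D D' (F : pred (edge G)) ep tp :
  effective D' -> equivalent D' D ->
  (forall e t, F e -> 0 < t < len e -> coeff (epoint e t) D <= 0) ->
  (forall e, exists t1, (0 < t1 < len e -> coeff (epoint e t1) D <= 1) /\
     forall t, 0 < t < len e -> t != t1 -> coeff (epoint e t) D <= 0) ->
  F ep -> 0 < tp < len ep -> 0 < coeff (epoint ep tp) D' ->
  exists2 S : vertex G -> Prop, (exists v, S v) &
    forall v, S v -> forall hs : seq (edge G * bool), uniq hs ->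
    (forall h, h \in hs ->
       [/\ F h.1, endv h = v & h.1 = ep \/ ~ S (endv (h.1, ~~ h.2))]) ->
    (size hs)%:Z <= coeff (vpoint v) D.
Proof.
move=> D'0 [f Hf fD] F0 one Fep tpe Dp.
have ordE p : ord_at f p = coeff p D' - coeff p D by rewrite -fD coeffB.
have [q0 Hq0] := piecewise_linear_min (vertex_gt0 G) Hf.
have oF e t : F e -> 0 < t < len e -> 0 <= ord_at f (epoint e t).
  by move=> Fe te; rewrite ordE; have := F0 e t Fe te; have := D'0 (epoint e t); lia.
(* The unburnt vertices are those where [f] attains its minimum. *)
exists (fun v => f (vpoint v) = f q0).
  apply: (min_at_vertex Hf Hq0) => e; have [t1 [one1 one2]] := one e.
  exists t1; split=> [t1e|t te tt1]; rewrite ordE.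
    by have := one1 t1e; have := D'0 (epoint e t1); lia.
  by have := one2 t te tt1; have := D'0 (epoint e t); lia.
move=> v Sv hs uhs Hhs.
have : - coeff (vpoint v) D <= ord_at f (vpoint v).
  by rewrite ordE; have := D'0 (vpoint v); lia.
rewrite ord_at_vertex lerN2; apply: le_trans.
have -> : (size hs)%:Z = \sum_(h <- hs) 1%:Z.
  by rewrite big_const_seq count_predT iter_addr addr0 natz.
rewrite (big_uniq _ uhs) /= big_mkcond [leRHS]big_mkcond /=; apply: ler_sum => h _.
case: ifP => [/Hhs[Fh eh nSh]|_].
  rewrite eh eqxx; have l0 := len_gt0 h.1.
  case: nSh => [hep|nSh].
    apply: (outgoing_slope_gt0 Hf Hq0 (t := tp)) => //; rewrite ?hep ?eh//; last 2 first.
    - lra.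
    (* A minimum at the starting point of the fire would make the order nonpositive there, although
       [D'] has a chip at that point and [D] has none. *)
    - move=> mp; have fp p : f (epoint ep tp) <= f p by rewrite mp.
      have : slope_left (f \o epoint ep) tp <= 0.
        apply: (left_slope_le0 (d := 0)) (pl_left_slope Hf _) => [|x _|]; try lra.
        exact: fp.
      have : 0 <= slope_right (f \o epoint ep) tp.
        apply: (right_slope_ge0 (d := len ep)) (pl_right_slope Hf _) => [|x _|]; try lra.
        exact: fp.
      have := ordE (epoint ep tp); rewrite ord_at_edge//.
      by have := F0 _ _ Fep tpe; lia.
    - by move=> s se; apply: oF.
  pose t := if h.2 then len h.1 else 0.
  apply: (outgoing_slope_gt0 Hf Hq0 (t := t)); rewrite ?eh//.
  - by move=> s; apply: oF.
  - by rewrite /t; case: h.2; rewrite lexx ?andbT ltW.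
  - move: nSh; rewrite /t /endv /=.
    by case: h.2 => /= nS; [rewrite epoint_tgt | rewrite epoint_src].
by case: ifP => // /eqP eh; apply: (outgoing_slope_ge0 Hf Hq0); rewrite eh.
Qed.

End Dhar.

(** * Rank and Brill-Noether rank *)

Section Rank.
Variables (R : realType) (G : metricGraph R).
Implicit Types (e : edge G) (v : vertex G) (p q x y : point G) (D E : divisor G).

Lemma effectiveD D E : effective D -> effective E -> effective (D + E).
Proof. by move=> D0 E0 p; rewrite coeffD; apply: addr_ge0. Qed.

Lemma effectiveU (k : int) p : 0 <= k -> effective (<< k *g p >> : divisor G).
Proof. by move=> k0 q; rewrite coeffU mulr_ge0. Qed.

Lemma effective_deg1 D : effective D -> deg D = 1 -> exists p, D = << p >>.
Proof. by move=> /fgposP; exact: deg1pos. Qed.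

(** Burn from a chip of [D] with no chip in the way: an unburnt vertex would keep its neighbours
    unburnt, hence by connectedness all vertices, including an end of the burning edge. This takes
    the place of the fact that principal divisors have degree 0. *)
Lemma principal_effective D e t : principal D -> effective D ->
  0 < t < len e -> coeff (epoint e t) D = 0.
Proof.
move=> Dp D0 te; apply/eqP; rewrite eq_le D0 andbT leNgt; apply/negP => ct.
have c0 p : coeff p (0 : divisor G) = 0 by exact: coeff0.
have [|||S [v Sv] HS] := @burning _ _ 0 D xpredT e t D0 _ _ _ isT te ct.
- by rewrite /equivalent subr0.
- by move=> e' t' _ _; rewrite c0.
- by move=> e'; exists 0; split=> [|t' _ _]; rewrite c0.
have S_adj h : S (endv h) -> S (endv (h.1, ~~ h.2)).
  move=> Sh; apply: contrapT => nS; have := HS _ Sh [:: h] isT.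
  rewrite coeff0 => /(_ _)/wrap[h'|//]; rewrite inE => /eqP ->; split=> //.
  by right.
have Sw w : S w.
  have /connectP[s ps ->] := graph_connected v w.
  elim: s v Sv ps => //= u s IH v Sv /andP[/existsP[e'] E ps]; apply: IH ps.
  case/orP: E => /andP[/eqP E1 /eqP E2].
    by have := S_adj (e', true); rewrite /endv /= E1 E2; apply.
  by have := S_adj (e', false); rewrite /endv /= E1 E2; apply.
have := HS _ (Sw (src e)) [:: (e, true)] isT; rewrite coeff0 => /(_ _)/wrap[h|//].
by rewrite inE => /eqP ->; split=> //; left.
Qed.

Lemma largestE (A : set int) m : A m -> (forall n, A n -> n <= m) -> largest A = m.
Proof.
move=> Am Hm; apply: xget_unique => // n [An Hn].
by apply/eqP; rewrite eq_le Hm// Hn.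
Qed.

(** The bound [b] guarantees that a maximum exists, so that [largest] does not fall back on its
    default. *)
Lemma largest_ge (A : set int) m b :
  0 <= m -> A m -> (forall n, A n -> n <= b) -> m <= largest A.
Proof.
move=> m0 Am Hb; pose P n := `[< A n%:Z >].
have exP : exists n, P n by exists `|m|%N; apply/asboolP; rewrite gez0_abs.
have bP n : P n -> (n <= `|b|)%N by move=> /asboolP/Hb; lia.
case: (ex_maxnP exP bP) => n /asboolP An Hn.
have H k : A k -> k <= n.
  move=> Ak; have [k0|k0] := leP 0 k; last lia.
  by have /Hn : P `|k|%N by [apply/asboolP; rewrite gez0_abs]; lia.
by rewrite (largestE An H); apply: H.
Qed.

Lemma rank_ge1P D p : 1 <= rank D ->
  exists2 D', equivalent D' D & effective (D' - << p >>).
Proof.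
rewrite /rank; case: asboolP => // _; rewrite /largest.
case: xgetP => [m _ [Am _] m1|_]; last by [].
(* The rank [m] may exceed 1: [m] chips are subtracted at [p], and [m - 1] of them are given
   back. *)
have [||D' eD D'E] := Am (<< m *g p >>); first by apply: effectiveU; lia.
  by rewrite degU.
exists D' => //; have -> : D' - << p >> = (D' - << m *g p >>) + << (m - 1) *g p >>.
  by rewrite -freegUB addrA subrK.
by apply: effectiveD => //; apply: effectiveU; lia.
Qed.

Lemma rank_ge1 D e t : effective D -> 0 < t < len e ->
  (forall p, exists2 D', equivalent D' D & effective (D' - << p >>)) -> 1 <= rank D.
Proof.
move=> D0 te H; rewrite /rank; case: asboolP => [_|[]]; last first.
  by exists D => //; exact: equivalent_refl.
apply: (@largest_ge _ _ (deg D)) => // [E E0 /(effective_deg1 E0)[p ->]|m Am].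
  exact: H.
rewrite leNgt; apply/negP => mD.
(* An [m] above the degree is tested on [D] plus [k] chips at [q]: then [D' - D] would be principal
   and effective with a chip at the interior point [q]. *)
pose q := epoint e t; pose k := m - deg D.
have k0 : 0 < k by rewrite /k; lia.
have [||D' eD D'E] := Am (D + << k *g q >>).
- by apply: effectiveD => //; apply: effectiveU; lia.
- by rewrite degD degU /k; lia.
have DD : D' - D = (D' - (D + << k *g q >>)) + << k *g q >> by rewrite opprD addrA subrK.
have : coeff q (D' - D) = 0.
  apply: (principal_effective eD) te => //.
  by rewrite DD; apply: effectiveD => //; apply: effectiveU; lia.
rewrite DD coeffD coeffU eqxx mulr1; have := D'E q; lia.
Qed.

(** The class of [D0] can be represented through any given point, which gives the value 0; no
    divisor of degree 3 and rank at least 1 contains [z1] and [z2], which excludes larger values. *)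
Lemma BN_rank13_eq0 D0 e t z1 z2 : 0 < t < len e ->
  effective D0 -> deg D0 = 3 ->
  (forall p, exists x y, equivalent (<< p >> + << x >> + << y >>) D0) ->
  (forall x, exists p, forall D, effective D ->
     equivalent D (<< z1 >> + << z2 >> + << x >>) -> coeff p D <= 0) ->
  BN_rank G 1 3 = 0.
Proof.
move=> te D0e D0d cov ncov.
have rk D : effective D -> equivalent D D0 -> 1%:Z <= rank D.
  move=> De DD0; apply: rank_ge1 De te _ => p.
  have [x [y pxy]] := cov p; exists (<< p >> + << x >> + << y >>).
    exact/(equivalent_trans pxy)/equivalent_sym.
  by rewrite -(addrA << p >>) addrAC subrr add0r; apply: effectiveD; apply: effectiveU.
rewrite /BN_rank; case: asboolP => [_|[]]; last first.
  exists (divisor_class D0), D0 => //; split; first by rewrite D0d.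
  by apply: rk => //; exact: equivalent_refl.
apply: largestE => [E E0|n An].
  rewrite addr0 => /(effective_deg1 E0)[p ->].
  have [x [y pxy]] := cov p; exists (<< p >> + << x >> + << y >>); split.
  - by rewrite !degD !degU.
  - by apply: rk => //; do 2?apply: effectiveD; apply: effectiveU.
  - by rewrite -(addrA << p >>) addrAC subrr add0r; apply: effectiveD; apply: effectiveU.
rewrite leNgt; apply/negP => n0.
(* A value [n] at least 1 is tested on [n] chips at [z1] and one at [z2]. Giving back [n - 1] of
   them leaves [D] minus [z1] and [z2] effective of degree 1, hence a single point [x]. *)
have [||D [Dd Dr DE]] := An (<< n *g z1 >> + << z2 >>).
- by apply: effectiveD; apply: effectiveU; lia.
- by rewrite degD !degU addrC.
have DE' : D - (<< z1 >> + << z2 >>) =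
    (D - (<< n *g z1 >> + << z2 >>)) + << (n - 1) *g z1 >>.
  by apply/eqP/freeg_eqP => q; rewrite !(coeffB, coeffD, coeffU); ring.
have [||x Dx] := @effective_deg1 (D - (<< z1 >> + << z2 >>)).
- by rewrite DE'; apply: effectiveD => //; apply: effectiveU; lia.
- by rewrite degB degD !degU Dd.
have [p Hp] := ncov x.
have [D' eD' D'p] := rank_ge1P p Dr.
have : effective D'.
  by rewrite -[D'](subrK << p >>); apply: effectiveD => //; apply: effectiveU.
move=> /Hp; rewrite -Dx subrKC => /(_ eD').
by have := D'p p; rewrite coeffB coeffU eqxx; lia.
Qed.

End Rank.

(** * Moving chips on a loop of loops *)

Section SameEdge.
Variables (R : realType) (G : metricGraph R).

(** The two displacements cancel, so the potential can be taken to vanish at all vertices. *)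
Lemma edge_equivalent (e : edge G) (s s' u u' : R) :
  0 <= s <= len e -> 0 <= s' <= len e -> 0 <= u <= len e -> 0 <= u' <= len e ->
  s + s' = u + u' ->
  equivalent (<< epoint e u >> + << epoint e u' >> : divisor G)
             (<< epoint e s >> + << epoint e s' >>).
Proof.
move=> sl s'l ul u'l E.
have := @moves_equivalent _ G [:: (e, (s, u)); (e, (s', u'))] (fun=> 0).
rewrite !big_cons !big_nil !addr0 /=; apply.
  by move=> m; rewrite !inE => /orP[] /eqP ->; rewrite ?sl ?s'l.
by move=> e'; rewrite !big_cons big_nil /=; case: (e == e'); lra.
Qed.

End SameEdge.

Lemma ordS3 (i : 'I_3) : ordS (ordS (ordS i)) = i.
Proof. by case: i => [[|[|[|//]]] Hi]; apply: val_inj. Qed.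

Lemma ordS_neq (i : 'I_3) :
  ((i == ordS i) = false) * ((ordS i == i) = false) *
  ((i == ordS (ordS i)) = false) * ((ordS (ordS i) == i) = false) *
  ((ordS i == ordS (ordS i)) = false) * ((ordS (ordS i) == ordS i) = false).
Proof. by case: i => [[|[|[|//]]] Hi]. Qed.

(** Indices are described relative to a base index [i], in keeping with the rotational symmetry of
    the graph. *)
Variant I3_spec (i : 'I_3) : 'I_3 -> Type :=
| I3_0 : I3_spec i i | I3_1 : I3_spec i (ordS i) | I3_2 : I3_spec i (ordS (ordS i)).

Lemma I3P (i x : 'I_3) : I3_spec i x.
Proof.
case: (eqVneq x i) => [->|xi]; first by constructor.
case: (eqVneq x (ordS i)) => [->|xsi]; first by constructor.
rewrite (_ : x = ordS (ordS i)); first by constructor.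
by case: i x xi xsi => [[|[|[|//]]] Hi] [[|[|[|//]]] Hx] //= _ _; apply: val_inj.
Qed.

Lemma argmax3 (R : realType) (a : 'I_3 -> R) : exists i, forall x, a x <= a i.
Proof.
case: (@arg_maxP _ _ _ ord0 xpredT a) => // i _ Hi.
by exists i => x; apply: Hi.
Qed.

Section LoopOfLoops.
Variables (R : realType) (l : lol_edge -> R) (l_gt0 : forall e, 0 < l e).
Let G := loop_of_loops l_gt0.
Implicit Types (i x y : 'I_3) (b : bool) (s h u : R).

Definition link x : lol_edge := inl x.
Definition arc x b : lol_edge := inr (x, b).

Definition lolpt (e : lol_edge) s : point G := @epoint R G e s.

Lemma link_eq x y : (link x == link y) = (x == y). Proof. by []. Qed.
Lemma arc_eq x y b b' : (arc x b == arc y b') = (x == y) && (b == b').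
Proof. by []. Qed.
Lemma link_arc x y b : (link x == arc y b) = false. Proof. by []. Qed.
Lemma arc_link x y b : (arc x b == link y) = false. Proof. by []. Qed.
Lemma inl_eq x y : (inl x == inl y :> lol_vertex) = (x == y). Proof. by []. Qed.
Lemma inr_eq x y : (inr x == inr y :> lol_vertex) = (x == y). Proof. by []. Qed.
Lemma inl_inr x y : (inl x == inr y :> lol_vertex) = false. Proof. by []. Qed.
Lemma inr_inl x y : (inr x == inl y :> lol_vertex) = false. Proof. by []. Qed.

Definition lolE := (link_eq, arc_eq, link_arc, arc_link, inl_eq, inr_eq, inl_inr, inr_inl).

Variant edge_spec i : lol_edge -> Type :=
| EdgeLink x of I3_spec i x : edge_spec i (link x)
| EdgeArc x b of I3_spec i x : edge_spec i (arc x b).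

Lemma edgeP i e : edge_spec i e.
Proof. by case: e => [x|[x b]]; constructor; apply: I3P. Qed.

(** The two links cut off the loop between them; the potential is [- h] on that loop and 0 on the
    other vertices. *)
Lemma links_equivalent i s s' h :
  0 <= s <= l (link i) -> 0 <= s - h <= l (link i) ->
  0 <= s' <= l (link (ordS i)) -> 0 <= s' + h <= l (link (ordS i)) ->
  equivalent (<< lolpt (link i) (s - h) >> + << lolpt (link (ordS i)) (s' + h) >>)
             (<< lolpt (link i) s >> + << lolpt (link (ordS i)) s' >>).
Proof.
move=> s0 s1 s'0 s'1; pose g (v : lol_vertex) :=
  if v \in [:: inr i; inl (ordS i)] then - h else 0.
have := @moves_equivalent _ G
  [:: (link i, (s, s - h)); (link (ordS i), (s', s' + h))] g.
rewrite !big_cons !big_nil !addr0 /=; apply.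
  by move=> m; rewrite !inE => /orP[] /eqP ->; rewrite /= ?s0 ?s1 ?s'0.
move=> e; rewrite !big_cons big_nil /= /g.
case: e / (edgeP i) => [x []|x b []];
  rewrite /= !inE !(lolE, ordS3, ordS_neq i, eqxx) /=; lra.
Qed.

(** A link and both arcs of a loop [j] other than loop [i] cut the graph in two; the potential is
    [- h] on the side of [w_i] and 0 on the side of [v_i]. *)
Lemma link_arcs_equivalent i j b s u u' h : j = ordS i \/ j = ordS (ordS i) ->
  0 <= s <= l (link i) -> 0 <= s - h <= l (link i) ->
  0 <= u <= l (arc j b) -> 0 <= u + h <= l (arc j b) ->
  0 <= u' <= l (arc j (~~ b)) -> 0 <= u' + h <= l (arc j (~~ b)) ->
  equivalent (<< lolpt (link i) (s - h) >> + << lolpt (arc j b) (u + h) >> +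
              << lolpt (arc j (~~ b)) (u' + h) >>)
             (<< lolpt (link i) s >> + << lolpt (arc j b) u >> +
              << lolpt (arc j (~~ b)) u' >>).
Proof.
move=> Hj s0 s1 u0 u1 u'0 u'1; pose g (v : lol_vertex) :=
  if v \in [:: inr i; inl (ordS i); inr (ordS i)] then - h
  else if v \in [:: inl (ordS (ordS i)); inr (ordS (ordS i))] then
    if j == ordS i then 0 else - h
  else 0.
have := @moves_equivalent _ G
  [:: (link i, (s, s - h)); (arc j b, (u, u + h)); (arc j (~~ b), (u', u' + h))] g.
rewrite !big_cons !big_nil !addr0 !addrA /=; apply.
  by move=> m; rewrite !inE => /or3P[] /eqP ->; rewrite /= ?s0 ?s1 ?u0 ?u1 ?u'0.
move=> e; rewrite !big_cons big_nil /= /g {g}.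
case: Hj => ->; case: e / (edgeP i) => [x []|x b' []];
  rewrite /= !inE !(lolE, ordS3, ordS_neq i, eqxx) /=;
  try (case: b'; case: (b) => /=); lra.
Qed.

Lemma lolpt_w x b : lolpt (arc x b) 0 = lolpt (link x) (l (link x)).
Proof. by rewrite /lolpt epoint_src// epoint_tgt. Qed.

Lemma lolpt_v x b : lolpt (arc x b) (l (arc x b)) = lolpt (link (ordS x)) 0.
Proof. by rewrite /lolpt epoint_tgt// epoint_src. Qed.

Lemma lolptP (p : point G) : exists e s, 0 <= s <= l e /\ p = lolpt e s.
Proof.
case: p / (pointP) => [[x|x]|e t te].
- by exists (link x), 0; rewrite lexx ltW//; split=> //; rewrite /lolpt epoint_src.
- by exists (link x), (l (link x)); rewrite lexx ltW//; split=> //; rewrite /lolpt epoint_tgt.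
by exists e, t; split=> //; apply/andP; split; apply/ltW; case/andP: te.
Qed.

End LoopOfLoops.

(** * A divisor of degree 3 and rank 1 *)

Section Covering.
Variables (R : realType) (l : lol_edge -> R) (l_gt0 : forall e, 0 < l e).
Let G := loop_of_loops l_gt0.
Implicit Types (i x : 'I_3) (b : bool) (s h u : R) (e : lol_edge) (p q r : point G).
Local Notation pt := (lolpt l_gt0).

Section Reach.
Variable D0 : divisor G.

Definition reach p q r := equivalent (<< p >> + << q >> + << r >>) D0.

Definition covered p := exists q r, reach p q r.

Lemma reach_rotate p q r : reach p q r -> reach q r p.
Proof. by rewrite /reach -addrA addrC. Qed.

Lemma reach_swap p q r : reach p q r -> reach q p r.
Proof. by rewrite /reach (addrC << q >>). Qed.

Lemma reach_covered p q r : reach p q r -> [/\ covered p, covered q & covered r].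
Proof.
move=> H; split; first by exists q, r.
  by exists r, p; apply: reach_rotate.
by exists p, q; do 2 apply: reach_rotate.
Qed.

Lemma reach_edge e s s' u u' r : reach (pt e s) (pt e s') r ->
  0 <= s <= l e -> 0 <= s' <= l e -> 0 <= u <= l e -> 0 <= u' <= l e ->
  s + s' = u + u' -> reach (pt e u) (pt e u') r.
Proof.
move=> H s0 s'0 u0 u'0 E; apply: equivalent_trans H.
by apply: equivalentDr; apply: edge_equivalent.
Qed.

(** As one chip moves inwards to [u], the other moves to the mirror image [s + s' - u]. *)
Lemma covered_between e s s' r u : reach (pt e s) (pt e s') r ->
  0 <= s -> s <= u <= s' -> s' <= l e -> covered (pt e u).
Proof.
move=> H s0 su s'l; exists (pt e (s + s' - u)), r.
by apply: (reach_edge H); lra.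
Qed.

Lemma reach_links x s s' h r : reach (pt (link x) s) (pt (link (ordS x)) s') r ->
  0 <= s <= l (link x) -> 0 <= s - h <= l (link x) ->
  0 <= s' <= l (link (ordS x)) -> 0 <= s' + h <= l (link (ordS x)) ->
  reach (pt (link x) (s - h)) (pt (link (ordS x)) (s' + h)) r.
Proof.
move=> H *; apply: equivalent_trans H.
by apply: equivalentDr; apply: links_equivalent.
Qed.

Lemma reach_arcs i j b s u u' h :
  reach (pt (link i) s) (pt (arc j b) u) (pt (arc j (~~ b)) u') ->
  j = ordS i \/ j = ordS (ordS i) ->
  0 <= s <= l (link i) -> 0 <= s - h <= l (link i) ->
  0 <= u <= l (arc j b) -> 0 <= u + h <= l (arc j b) ->
  0 <= u' <= l (arc j (~~ b)) -> 0 <= u' + h <= l (arc j (~~ b)) ->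
  reach (pt (link i) (s - h)) (pt (arc j b) (u + h)) (pt (arc j (~~ b)) (u' + h)).
Proof. by move=> H *; apply: equivalent_trans H; apply: link_arcs_equivalent. Qed.

(** The two chips sit at the two ends of either arc of loop [x], and can approach each other along
    it. *)
Lemma covered_loop x b r u : reach (pt (link x) (l (link x))) (pt (link (ordS x)) 0) r ->
  0 <= u <= l (arc x b) -> covered (pt (arc x b) u).
Proof.
rewrite -(lolpt_w l_gt0 x b) -(lolpt_v l_gt0 x b) => H u0.
by apply: (covered_between H).
Qed.

End Reach.

Variables (i : 'I_3) (bj bk : bool) (t : R).
Local Notation j := (ordS i).
Local Notation k := (ordS (ordS i)).
Local Notation B := (arc j bj).
Local Notation C := (arc j (~~ bj)).
Local Notation B' := (arc k bk).
Local Notation C' := (arc k (~~ bk)).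
Local Notation ai := (l (link i)).
Local Notation aj := (l (link j)).
Local Notation ak := (l (link k)).
Hypotheses (aji : aj <= ai) (aki : ak <= ai) (BC : l B <= l C) (BC' : l B' <= l C').
Hypotheses (t_ge0 : 0 <= t) (t_leB : t <= l B) (t_le : t <= ai - aj).

Ltac lra_abs :=
  repeat match goal with
  | H : is_true _ |- _ => revert H
  | H : @eq (Real.sort R) _ _ |- _ => revert H
  end;
  repeat match goal with |- context [l ?e] => generalize (l e) end;
  move=> *; lra.

Ltac lra_pos := pose proof (l_gt0 (link i)); pose proof (l_gt0 (link j));
  pose proof (l_gt0 (link k)); pose proof (l_gt0 B); pose proof (l_gt0 C);
  pose proof (l_gt0 B'); pose proof (l_gt0 C'); lra_abs.

(* The first two points are w_i and v_j; the third is at distance [t] from v_k. *)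
Definition pencil : divisor G :=
  << pt (link i) ai >> + << pt (link j) 0 >> + << pt C (l C - t) >>.

Let reach0 : reach pencil (pt (link i) ai) (pt (link j) 0) (pt C (l C - t)).
Proof. exact: equivalent_refl. Qed.

(** First stage: the chip at [w_i] retreats along [link i] while the chip at [v_j] advances to
    [w_j]. *)
Let reach1 h : 0 <= h <= aj ->
  reach pencil (pt (link i) (ai - h)) (pt (link j) h) (pt C (l C - t)).
Proof.
move=> h0; rewrite -{2}[h]add0r.
by apply: (reach_links reach0); lra_pos.
Qed.

(** Second stage: the chip now at [w_j], the start of [B], and the chip on [C] advance together by
    at most [t], still compensated on [link i]. At the end the chip on [C] is at [v_k]. *)
Let reach2 h : 0 <= h <= t ->
  reach pencil (pt (link i) (ai - aj - h)) (pt B h) (pt C (l C - t + h)).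
Proof.
move=> h0; rewrite -{2}[h]add0r.
apply: reach_arcs; [|by left|lra_pos..].
by rewrite lolpt_w; apply: reach1; lra_pos.
Qed.

Local Notation y := (ai - aj - t).

Let reach3 : reach pencil (pt (link i) y) (pt B t) (pt (link k) 0).
Proof. by have := @reach2 t ltac:(lra_abs); rewrite subrK lolpt_v. Qed.

Let covered_j u : 0 <= u <= aj -> covered pencil (pt (link j) u).
Proof. by move=> /reach1/reach_covered[]. Qed.

Let covered_loop_i b u : 0 <= u <= l (arc i b) -> covered pencil (pt (arc i b) u).
Proof. exact: (covered_loop reach0). Qed.

Let covered_C u : 0 <= u <= l C -> covered pencil (pt C u).
Proof.
move=> u0; have [ut|tu] := leP u (l C - t); last first.
  by have /reach_covered[_ _] := @reach2 (u - (l C - t)) ltac:(lra_abs); rewrite subrKC.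
have := @reach1 aj ltac:(lra_pos); rewrite -(lolpt_w l_gt0 j (~~ bj)) => /reach_rotate H.
by apply: (covered_between H); lra_abs.
Qed.

Let covered_B u : 0 <= u <= l B -> covered pencil (pt B u).
Proof.
move=> u0; have [ut|tu] := leP u t.
  by have /reach_covered[] := @reach2 u ltac:(lra_abs).
have := reach3; rewrite -(lolpt_v l_gt0 j bj) => /reach_rotate H.
by apply: (covered_between H); lra_abs.
Qed.

Let covered_i_right u : y <= u <= ai -> covered pencil (pt (link i) u).
Proof.
move=> yu; have [ut|tu] := leP (ai - aj) u.
  by have /reach_covered[+ _ _] := @reach1 (ai - u) ltac:(lra_abs); rewrite opprB subrKC.
by have /reach_covered[+ _ _] := @reach2 (ai - aj - u) ltac:(lra_abs); rewrite opprB subrKC.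
Qed.

(** Third stage: the chip at [v_k] advances along [link k] while the one on [link i] retreats
    further; the chip on [B] rests. *)
Let reach4 h : 0 <= h <= ak -> h <= y ->
  reach pencil (pt (link k) h) (pt (link i) (y - h)) (pt B t).
Proof.
move=> h0 hy; have := @reach_links pencil k 0 y (- h) (pt B t).
rewrite ordS3 opprK add0r; apply; [|lra_pos..].
exact/reach_rotate/reach_rotate.
Qed.

(* What remains once the chips have left [link j] and loop [j]. *)
Definition rest_covered := [/\ forall u, 0 <= u <= y -> covered pencil (pt (link i) u),
  forall u, 0 <= u <= ak -> covered pencil (pt (link k) u) &
  forall b u, 0 <= u <= l (arc k b) -> covered pencil (pt (arc k b) u)].

Let covered_loop_k b r u : reach pencil (pt (link k) ak) (pt (link i) 0) r ->
  0 <= u <= l (arc k b) -> covered pencil (pt (arc k b) u).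
Proof. by move=> H; apply: (@covered_loop _ k b r); rewrite ordS3. Qed.

(** Here [y = ak]: the moving chips reach [w_k] and [v_i] at the same time, ready to sweep loop
    [k]. *)
Let rest1 : t = ai - aj - ak -> rest_covered.
Proof.
move=> tT; split=> [u u0|u u0|b u u0].
- have /reach_covered[_ + _] := @reach4 (y - u) ltac:(lra_abs) ltac:(lra_abs).
  by rewrite opprB subrKC.
- by have /reach_covered[] := @reach4 u ltac:(lra_abs) ltac:(lra_abs).
- have := @reach4 ak ltac:(lra_pos) ltac:(lra_abs).
  by rewrite (_ : y - ak = 0); [move=> /covered_loop_k; apply | lra_abs].
Qed.

(** The chip on [link i] reaches [v_i] while the one on [link k] is only at [y]. As [t = 0], the
    resting chip is at [w_j]; it retreats along [link j] and lets the chip on [link k] go on to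
    [w_k]. There is room for this since [ak <= ai]. *)
Let rest2 : ai - aj <= ak -> t = 0 -> rest_covered.
Proof.
move=> T0 t0; have yE : y = ai - aj by rewrite t0 subr0.
have S4 h : 0 <= h <= ak - y ->
    reach pencil (pt (link j) (aj - h)) (pt (link k) (y + h)) (pt (link i) 0).
  move=> h0; have := @reach4 y ltac:(lra_abs) ltac:(lra_abs).
  rewrite subrr (_ : pt B t = pt (link j) aj) => [H|]; last by rewrite t0 lolpt_w.
  by apply: reach_links; [do 2 apply: reach_rotate | lra_pos..].
split=> [u u0|u u0|b u u0].
- have /reach_covered[_ + _] := @reach4 (y - u) ltac:(lra_abs) ltac:(lra_abs).
  by rewrite opprB subrKC.
- have [uy|yu] := leP u y.
    by have /reach_covered[] := @reach4 u ltac:(lra_abs) ltac:(lra_abs).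
  by have /reach_covered[_ + _] := S4 (u - y) ltac:(lra_abs); rewrite subrKC.
- have := S4 (ak - y) ltac:(lra_abs); rewrite subrKC.
  by move=> /reach_rotate/covered_loop_k; apply.
Qed.

(** The chip on [B] has also reached [v_k], so two chips can cross [link k] one after the other,
    both compensated on [link i]. *)
Let rest3 : ak + l B < ai - aj -> t = l B -> rest_covered.
Proof.
move=> T0 tB; have Bk : pt B t = pt (link k) 0 by rewrite tB lolpt_v.
have S4 h : 0 <= h <= ak -> h <= y - ak ->
    reach pencil (pt (link k) h) (pt (link i) (y - ak - h)) (pt (link k) ak).
  move=> h0 hy; have := @reach_links pencil k 0 (y - ak) (- h) (pt (link k) ak).
  rewrite ordS3 opprK add0r; apply; [|lra_pos..].
  by have := @reach4 ak ltac:(lra_pos) ltac:(lra_abs); rewrite Bk => /reach_rotate/reach_swap.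
have cov_k u : 0 <= u <= ak -> covered pencil (pt (link k) u).
  by move=> u0; have /reach_covered[] := @reach4 u ltac:(lra_abs) ltac:(lra_abs).
have cov_i1 u : y - ak <= u <= y -> covered pencil (pt (link i) u).
  move=> u0; have /reach_covered[_ + _] := @reach4 (y - u) ltac:(lra_abs) ltac:(lra_abs).
  by rewrite opprB subrKC.
have cov_i2 u : 0 <= u -> y - ak - ak <= u <= y - ak -> covered pencil (pt (link i) u).
  move=> u0 uy; have /reach_covered[_ + _] := S4 (y - ak - u) ltac:(lra_abs) ltac:(lra_abs).
  by rewrite opprB subrKC.
have [yk|ky] := leP (y - ak) ak.
  split=> [u u0||b u u0] //.
    by have [uy|yu] := leP u (y - ak); [apply: cov_i2 | apply: cov_i1]; lra_abs.
  have := S4 (y - ak) ltac:(lra_abs) ltac:(lra_abs).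
  by rewrite subrr => /reach_rotate/reach_swap/covered_loop_k; apply.
(* The chip on [link i] has not reached [v_i] yet, and both other chips are at [w_k]: they now cross
   loop [k] together. *)
have S5 h : 0 <= h <= l B' -> h <= y - ak - ak ->
    reach pencil (pt (link i) (y - ak - ak - h)) (pt B' h) (pt C' h).
  move=> h0 hy; rewrite -{2 3}[h]add0r; apply: reach_arcs; [|by right|lra_pos..].
  rewrite !lolpt_w; apply: reach_swap; apply: S4; lra_pos.
(* The crossing stops when the chip on [link i] reaches [v_i] or when the shorter arc [B'] is
   exhausted. *)
pose H : R := Num.min (y - ak - ak) (l B').
have H0 : 0 <= H by rewrite le_min; lra_pos.
have HB : H <= l B' by rewrite ge_min lexx orbT.
have Hy : H <= y - ak - ak by rewrite ge_min lexx.
have HE : H = y - ak - ak \/ H = l B' by rewrite /H; case: leP; [left | right].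
clearbody H.
have vk b : pt (arc k b) (l (arc k b)) = pt (link i) 0 by rewrite lolpt_v ordS3.
have cov_i3 u : y - ak - ak - H <= u <= y - ak - ak -> covered pencil (pt (link i) u).
  move=> u0; have /reach_covered[+ _ _] := S5 (y - ak - ak - u) ltac:(lra_abs) ltac:(lra_abs).
  by rewrite opprB subrKC.
have S5H := S5 H ltac:(lra_abs) ltac:(lra_abs).
(* If [B'] is exhausted first, its chip is at [v_i], and it closes the remaining gap on [link i]
   together with the chip there. *)
have cov_i4 u : 0 <= u <= y - ak - ak - H -> covered pencil (pt (link i) u).
  move=> u0; case: HE => HE; first by apply: cov_i3; lra_abs.
  move: S5H; rewrite {2}HE vk => /reach_swap S5H.
  by apply: (covered_between S5H); lra_pos.
have cov_B u : 0 <= u <= l B' -> covered pencil (pt B' u).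
  move=> u0; have [uH|Hu] := leP u H.
    by have /reach_covered[] := S5 u ltac:(lra_abs) ltac:(lra_abs).
  case: HE => HE; last by suff : u <= H; [rewrite leNgt Hu | lra_abs].
  move: S5H; rewrite {1}HE subrr -(vk bk) => /reach_swap S5H.
  by apply: (covered_between S5H); lra_pos.
have cov_C u : 0 <= u <= l C' -> covered pencil (pt C' u).
  move=> u0; have [uH|Hu] := leP u H.
    by have /reach_covered[] := S5 u ltac:(lra_abs) ltac:(lra_abs).
  (* In both cases some chip is at [v_i], the far end of [C'], and can meet the chip at [H]. *)
  have S6 : exists r, reach pencil (pt C' H) (pt C' (l C')) r.
    rewrite vk; case: HE => HE.
      exists (pt B' H); move: S5H; rewrite {1}HE subrr.
      by move=> /reach_rotate/reach_rotate.
    exists (pt (link i) (y - ak - ak - H)); move: S5H; rewrite {2}HE vk.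
    by move=> /reach_rotate/reach_swap.
  by have [r S6r] := S6; apply: (covered_between S6r); lra_pos.
split=> // [u u0|b u u0].
  have [u1|u1] := leP (y - ak) u; first by apply: cov_i1; lra_abs.
  have [u2|u2] := leP (y - ak - ak) u; first by apply: cov_i2; lra_abs.
  by have [u3|u3] := leP (y - ak - ak - H) u; [apply: cov_i3 | apply: cov_i4]; lra_abs.
by move: u0; case: (eqVneq b bk) => [->|/negPf bbk] u0; [exact: cov_B|];
  move: u0; rewrite (_ : b = ~~ bk); [exact: cov_C | case: b bk bbk => [] []].
Qed.

Lemma pencil_covered p :
  t = Num.min (Num.max 0 (ai - aj - ak)) (l B) -> covered pencil p.
Proof.
(* The three possible values of the truncated quantity [t] are the cases [rest1], [rest2] and
   [rest3]. *)
move=> tE; have [Ri Rk Rlk] : rest_covered.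
  have [T0|T0] := leP (ai - aj) ak.
    by apply: rest2 => //; rewrite tE max_l ?min_l//; lra_pos.
  have [TB|TB] := leP (ai - aj - ak) (l B).
    by apply: rest1; rewrite tE max_r ?min_l//; lra_pos.
  by apply: rest3; [lra_abs | rewrite tE max_r ?min_r//; lra_pos].
have [e [s [s0 ->]]] := lolptP p.
move: s0; case: e / (edgeP i) => [x []|x b []] s0.
- by have [sy|ys] := leP s y; [apply: Ri | apply: covered_i_right]; lra_abs.
- exact: covered_j.
- exact: Rk.
- exact: covered_loop_i.
- move: s0; case: (eqVneq b bj) => [->|/negPf bbj] s0; first exact: covered_B.
  by move: s0; rewrite (_ : b = ~~ bj); [exact: covered_C | case: b bj bbj => [] []].
- exact: Rlk.
Qed.

End Covering.

(** * A divisor of degree 2 contained in no divisor of degree 3 and rank 1 *)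

Section NotCovered.
Variables (R : realType) (l : lol_edge -> R) (l_gt0 : forall e, 0 < l e).
Let G := loop_of_loops l_gt0.
Implicit Types (x : 'I_3) (b : bool) (s t u : R) (e : lol_edge) (p q r : point G).
Local Notation pt := (lolpt l_gt0).

(* [carried p es]: [es] lists the edge whose interior contains [p], if any. *)
Variant carried : point G -> seq lol_edge -> Prop :=
| CarriedVertex (v : lol_vertex) : carried (@vpoint R G v) [::]
| CarriedEdge e t of 0 < t < l e : carried (pt e t) [:: e].

Lemma carriedP p : exists es, carried p es.
Proof.
case: p / (pointP) => [v|e t te]; first by exists [::]; constructor.
by exists [:: e]; apply: CarriedEdge.
Qed.

Lemma interior_eq e e' t t' : 0 < t < l e -> 0 < t' < l e' ->
  (pt e t == pt e' t') = (e == e') && (t == t').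
Proof.
by move=> te te'; rewrite -val_eqE !epoint_val// -[inr _ == _]/((e, t) == (e', t')) xpair_eqE.
Qed.

Lemma interior_neq_vertex e t (v : lol_vertex) :
  0 < t < l e -> (pt e t == @vpoint R G v) = false.
Proof. by move=> te; rewrite -val_eqE epoint_val. Qed.

Lemma carried_interior p es e t : carried p es -> 0 < t < l e -> p = pt e t -> es = [:: e].
Proof.
case=> [v|e' t' te'] te /eqP; first by rewrite eq_sym interior_neq_vertex.
by rewrite interior_eq// => /andP[/eqP -> _].
Qed.

Lemma carried_notin p es e t :
  carried p es -> 0 < t < l e -> e \notin es -> (p == pt e t) = false.
Proof.
by move=> c te; apply: contraNF => /eqP/(carried_interior c te) ->; rewrite inE.
Qed.

(** The contribution of [e] to the count of burning edges at one of its ends, [v] being the other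
    end. Edges carrying a chip are excluded by [F]. *)
Definition fire (S : lol_vertex -> bool) (F : pred lol_edge) (ep e : lol_edge)
    (v : lol_vertex) : nat :=
  F e && ((e == ep) || ~~ S v).

Lemma lolpt_src e : pt e 0 = @vpoint R G (lol_src e).
Proof. by rewrite /lolpt epoint_src. Qed.

Lemma lolpt_tgt e : pt e (l e) = @vpoint R G (lol_tgt e).
Proof. by rewrite /lolpt epoint_tgt. Qed.

(** Uniqueness of the carrying edges means at most one chip in each open edge, as [burning]
    requires. The outcome is a boolean system on the six vertices, two inequalities for each
    loop. *)
Lemma burning3 (D' : divisor G) X1 X2 X3 es1 es2 es3 (ep : lol_edge) tp :
  carried X1 es1 -> carried X2 es2 -> carried X3 es3 -> uniq (es1 ++ es2 ++ es3) ->
  effective D' -> equivalent D' (<< X1 >> + << X2 >> + << X3 >>) ->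
  ep \notin es1 ++ es2 ++ es3 -> 0 < tp < l ep -> 0 < coeff (pt ep tp) D' ->
  let F e := e \notin es1 ++ es2 ++ es3 in
  let chips v := ((X1 == @vpoint R G v) + (X2 == @vpoint R G v) + (X3 == @vpoint R G v))%N in
  exists2 S : lol_vertex -> bool, exists v, S v & forall x,
    (S (inr x) ==> (fire S F ep (link x) (inl x) + fire S F ep (arc x true) (inl (ordS x)) +
         fire S F ep (arc x false) (inl (ordS x)) <= chips (inr x))%N) &&
    (S (inl (ordS x)) ==> (fire S F ep (link (ordS x)) (inr (ordS x)) +
         fire S F ep (arc x true) (inr x) + fire S F ep (arc x false) (inr x)
           <= chips (inl (ordS x)))%N).
Proof.
move=> c1 c2 c3 ues D'0 eD Fep tpe Dp F chips.
pose D : divisor G := << X1 >> + << X2 >> + << X3 >>.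
have cD q : coeff q D = ((X1 == q) + (X2 == q) + (X3 == q))%N%:Z.
  by rewrite /D !coeffD !coeff_point !PoszD.
have FD e t : F e -> 0 < t < l e -> coeff (pt e t) D <= 0.
  rewrite /F !mem_cat !negb_or => /and3P[e1 e2 e3] te.
  by rewrite cD (carried_notin c1 te e1) (carried_notin c2 te e2) (carried_notin c3 te e3).
have one e : exists t1, (0 < t1 < l e -> coeff (pt e t1) D <= 1) /\
    forall t, 0 < t < l e -> t != t1 -> coeff (pt e t) D <= 0.
  have neq X es : carried X es -> e \in es -> exists t1, X = pt e t1 /\ 0 < t1 < l e.
    by case=> [//|e' t' te']; rewrite inE => /eqP ->; exists t'.
  have [Fe|] := boolP (F e).
    by exists 0; split=> [|t te _]; [rewrite ltxx | apply: FD].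
  rewrite /F !mem_cat negbK => ee; move: ues; rewrite !cat_uniq !has_cat !negb_or.
  case/and3P => _ /andP[/hasPn /= n12 /hasPn /= n13] /and3P[_ /hasPn /= n23 _].
  case/or3P: ee => ee.
  - have [t1 [E t1e]] := neq _ _ c1 ee; exists t1.
    have n2 : e \notin es2 by apply: contraL ee => /n12.
    have n3 : e \notin es3 by apply: contraL ee => /n13.
    split=> [_|t te tt1]; rewrite cD.
      by rewrite (carried_notin c2 t1e n2) (carried_notin c3 t1e n3); case: (_ == _).
    rewrite (carried_notin c2 te n2) (carried_notin c3 te n3) E interior_eq//.
    by rewrite eq_sym (negPf tt1) andbF.
  - have [t1 [E t1e]] := neq _ _ c2 ee; exists t1.
    have n1 : e \notin es1 by apply: n12.
    have n3 : e \notin es3 by apply: contraL ee => /n23.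
    split=> [_|t te tt1]; rewrite cD.
      by rewrite (carried_notin c1 t1e n1) (carried_notin c3 t1e n3); case: (_ == _).
    rewrite (carried_notin c1 te n1) (carried_notin c3 te n3) E interior_eq//.
    by rewrite [t1 == t]eq_sym (negPf tt1) andbF.
  - have [t1 [E t1e]] := neq _ _ c3 ee; exists t1.
    have n1 : e \notin es1 by apply: n13.
    have n2 : e \notin es2 by apply: n23.
    split=> [_|t te tt1]; rewrite cD.
      by rewrite (carried_notin c1 t1e n1) (carried_notin c2 t1e n2); case: (_ == _).
    rewrite (carried_notin c1 te n1) (carried_notin c2 te n2) E interior_eq//.
    by rewrite [t1 == t]eq_sym (negPf tt1) andbF.
have [S' [v0 S'v0] HS] := burning D'0 eD FD one Fep tpe Dp.
exists (fun v => `[< S' v >]); first by exists v0; apply/asboolP.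
have fireP v (hs : seq (lol_edge * bool)) : uniq hs ->
    {in hs, forall h, endv (h : edge G * bool) = v} -> S' v ->
    (count (fun h : lol_edge * bool => F h.1 && ((h.1 == ep) ||
       ~~ `[< S' (@endv R G (h.1, ~~ h.2)) >])) hs <= chips v)%N.
  move=> uhs hv Sv; rewrite -size_filter -lez_nat -cD.
  apply: HS => //; first exact: filter_uniq.
  move=> h; rewrite mem_filter => /andP[/andP[Fh hS] hhs]; split=> //; first exact: hv.
  by case/orP: hS => [/eqP|/asboolPn]; [left | right].
move=> x; apply/andP; split; apply/implyP => /asboolP Sv.
  have := fireP (inr x) [:: (link x, false); (arc x true, true); (arc x false, true)].
  rewrite /= !inE !xpair_eqE !lolE /= !andbF => /(_ isT _ Sv); rewrite !addn0 addnA; apply.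
  by move=> h; rewrite !inE => /or3P[]/eqP->.
have := fireP (inl (ordS x))
  [:: (link (ordS x), true); (arc x true, false); (arc x false, false)].
rewrite /= !inE !xpair_eqE !lolE /= !andbF => /(_ isT _ Sv); rewrite !addn0 addnA; apply.
by move=> h; rewrite !inE => /or3P[]/eqP->.
Qed.


Definition blocked (D : divisor G) := exists p, forall D' : divisor G,
  effective D' -> equivalent D' D -> coeff p D' <= 0.

Lemma vertex_eq (v v' : lol_vertex) : (@vpoint R G v == @vpoint R G v') = (v == v').
Proof. by []. Qed.

(** A fire lit in the middle of the chipless edge [ep] must leave a vertex unburnt if some
    equivalent effective divisor has a chip there. The last hypothesis, a check of 64 assignments,
    says that everything burns. *)
Lemma blocked_of_burning X1 X2 X3 es1 es2 es3 ep (i : 'I_3) :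
  carried X1 es1 -> carried X2 es2 -> carried X3 es3 -> uniq (es1 ++ es2 ++ es3) ->
  let F e := e \notin es1 ++ es2 ++ es3 in
  let chips v := ((X1 == @vpoint R G v) + (X2 == @vpoint R G v) + (X3 == @vpoint R G v))%N in
  F ep ->
  (forall vi wi vj wj vk wk : bool,
    let count e (s : bool) e' (s' : bool) e'' (s'' : bool) :=
      ((F e && ((e == ep) || ~~ s)) + (F e' && ((e' == ep) || ~~ s')) +
      (F e'' && ((e'' == ep) || ~~ s'')))%N in
    let j := ordS i in let k := ordS j in
    [&& wi ==> (count (link i) vi (arc i true) vj (arc i false) vj <= chips (inr i))%N,
        vj ==> (count (link j) wj (arc i true) wi (arc i false) wi <= chips (inl j))%N,
        wj ==> (count (link j) vj (arc j true) vk (arc j false) vk <= chips (inr j))%N,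
        vk ==> (count (link k) wk (arc j true) wj (arc j false) wj <= chips (inl k))%N,
        wk ==> (count (link k) vk (arc k true) vi (arc k false) vi <= chips (inr k))%N &
        vi ==> (count (link i) wi (arc k true) wk (arc k false) wk <= chips (inl i))%N] ->
    ~~ [|| vi, wi, vj, wj, vk | wk]) ->
  blocked (<< X1 >> + << X2 >> + << X3 >>).
Proof.
move=> c1 c2 c3 ues F chips Fep H; exists (pt ep (l ep / 2)) => D' D'0 eD.
rewrite leNgt; apply/negP => Dp.
have tp : 0 < l ep / 2 < l ep.
  by have := l_gt0 ep; move: (l ep) => c; lra.
have [S [v Sv] HS] := burning3 c1 c2 c3 ues D'0 eD Fep tp Dp.
have {}H := H (S (inl i)) (S (inr i)) (S (inl (ordS i))) (S (inr (ordS i)))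
  (S (inl (ordS (ordS i)))) (S (inr (ordS (ordS i)))).
apply: (elimN idP (H _)).
  move: (HS i) (HS (ordS i)) (HS (ordS (ordS i))); rewrite ordS3.
  by move=> /andP[h1 h2] /andP[h3 h4] /andP[h5 h6]; apply/and5P; split=> //; apply/andP.
by move: Sv; case: v => x; case: x / (I3P i x) => ->; rewrite ?orbT.
Qed.



Ltac burn i eqs :=
  let vi := fresh in let wi := fresh in let vj := fresh in
  let wj := fresh in let vk := fresh in let wk := fresh in
  move=> vi wi vj wj vk wk;
  rewrite /= ?vertex_eq ?inE ?(lolE, ordS3, ordS_neq i, eqxx, eqs) /=;
  case: vi; case: wi; case: vj; case: wj; case: vk; case: wk.

Lemma blocked_rigid (i : 'I_3) s u X :
  let e := arc i true in let e' := arc (ordS i) true in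
  0 < s < l e -> 0 < u < l e' ->
  (forall t, 0 < t < l e -> X <> pt e t) -> (forall t, 0 < t < l e' -> X <> pt e' t) ->
  blocked (<< pt e s >> + << pt e' u >> + << X >>).
Proof.
move=> e e' se ue' Xe Xe'; rewrite {}/e {}/e' in se ue' Xe Xe' *.
have c1 := CarriedEdge se; have c2 := CarriedEdge ue'.
have P0 v := interior_neq_vertex v se; have Q0 v := interior_neq_vertex v ue'.
have [es c3] := carriedP X.
case: X es / c3 Xe Xe' => [v _ _|e0 t te Xe Xe'].
  apply: (blocked_of_burning (ep := arc (ordS i) false) (i := i) c1 c2 (CarriedVertex v));
    rewrite /= ?inE ?(lolE, ordS_neq i, eqxx) /= ?andbF //.
  by case: v => x; case: x / (I3P i x); burn i (P0, Q0).
have X0 v := interior_neq_vertex v te; have c0 := CarriedEdge te.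
(* The fire starts on the second arc of loop [ordS i], or on that of loop [i] if the third chip
   occupies the former. *)
pose ep := if e0 == arc (ordS i) false then arc i false else arc (ordS i) false.
have e0i : e0 != arc i true by apply/eqP => E; subst e0; exact: Xe te erefl.
have e0j : e0 != arc (ordS i) true by apply/eqP => E; subst e0; exact: Xe' te erefl.
apply: (blocked_of_burning (ep := ep) (i := i) c1 c2 c0); rewrite {}/ep.
- by rewrite /= !inE (eq_sym _ e0) (negPf e0i) (eq_sym _ e0) (negPf e0j) !lolE (ordS_neq i).
- rewrite /= !inE !negb_or; case: ifP => [/eqP->|/negbT e0f].
    by rewrite !lolE (ordS_neq i) eqxx.
  by rewrite !lolE (ordS_neq i) eqxx /= eq_sym.
case: e0 / (edgeP i) X0 e0i e0j {te Xe Xe' c0} => [x []|x b []] X0;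
  rewrite ?lolE ?(ordS_neq i) ?eqxx /=.
- by move=> _ _; burn i (P0, Q0, X0).
- by move=> _ _; burn i (P0, Q0, X0).
- by move=> _ _; burn i (P0, Q0, X0).
- by case: b X0 => // X0 _ _; burn i (P0, Q0, X0).
- by case: b X0 => // X0 _ _; burn i (P0, Q0, X0).
- by case: b X0 => X0 _ _; burn i (P0, Q0, X0).
Qed.


Lemma blocked_equivalent (D D' : divisor G) : equivalent D D' -> blocked D' -> blocked D.
Proof.
move=> DD' [p Hp]; exists p => D'' D''0 D''D; apply: Hp => //.
exact: equivalent_trans D''D DD'.
Qed.

(** This is what [w_i + v_j] becomes after sliding by the whole length of [link i]. The length bound
    keeps the second chip on [link j], at worst at [w_j]; only there does it become a vertex
    chip. *)
Lemma blocked_link_before (i : 'I_3) u : let j := ordS i in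
  l (link i) <= l (link j) -> 0 < u < l (arc j true) ->
  blocked (<< pt (link i) 0 >> + << pt (link j) (l (link i)) >> + << pt (arc j true) u >>).
Proof.
move=> j; rewrite {}/j => ij ue; have c3 := CarriedEdge ue.
have Q0 v := interior_neq_vertex v ue.
rewrite lolpt_src.
have c1 : carried (@vpoint R G (inl i)) [::] by constructor.
move: ij; rewrite le_eqVlt => /predU1P[ij|ij].
  rewrite ij lolpt_tgt.
  have c2 : carried (@vpoint R G (inr (ordS i))) [::] by constructor.
  by apply: (blocked_of_burning (ep := arc (ordS i) false) (i := i) c1 c2 c3);
    rewrite /= ?inE ?(lolE, ordS_neq i, eqxx) //; burn i Q0.
have ie : 0 < l (link i) < l (link (ordS i)) by rewrite l_gt0.
have P0 v := interior_neq_vertex v ie.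
by apply: (blocked_of_burning (ep := arc (ordS i) false) (i := i) c1 (CarriedEdge ie) c3);
  rewrite /= ?inE ?(lolE, ordS_neq i, eqxx) //; burn i (P0, Q0).
Qed.

(** The mirror image of [blocked_link_before]: [w_j + v_k] has slid by the whole length of [link k],
    and the chip retreating on [link j] gets at most to [v_j]. *)
Lemma blocked_link_after (i : 'I_3) s : let j := ordS i in let k := ordS j in
  l (link k) <= l (link j) -> 0 < s < l (arc i true) ->
  blocked (<< pt (arc i true) s >> + << pt (link k) (l (link k)) >> +
           << pt (link j) (l (link j) - l (link k)) >>).
Proof.
move=> j k; rewrite {}/k {}/j => kj se; have c1 := CarriedEdge se.
have Q0 v := interior_neq_vertex v se.
rewrite lolpt_tgt.
have c2 : carried (@vpoint R G (inr (ordS (ordS i)))) [::] by constructor.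
move: kj; rewrite le_eqVlt => /predU1P[kj|kj].
  rewrite kj subrr lolpt_src.
  have c3 : carried (@vpoint R G (inl (ordS i))) [::] by constructor.
  by apply: (blocked_of_burning (ep := arc i false) (i := i) c1 c2 c3);
    rewrite /= ?inE ?(lolE, ordS_neq i, eqxx) //; burn i Q0.
have je : 0 < l (link (ordS i)) - l (link (ordS (ordS i))) < l (link (ordS i)).
  by rewrite subr_gt0 kj gtrBl l_gt0.
have P0 v := interior_neq_vertex v je.
by apply: (blocked_of_burning (ep := arc i false) (i := i) c1 c2 (CarriedEdge je));
  rewrite /= ?inE ?(lolE, ordS_neq i, eqxx) //; burn i (P0, Q0).
Qed.

Lemma half_interior e : 0 < l e / 2 < l e.
Proof. by have := l_gt0 e; move: (l e) => c; lra. Qed.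

(** The chips at the middle and at [t] move apart until one reaches an end; both do so at once
    exactly when [t] is the middle. *)
Lemma edge_middle_equivalent e t : 0 < t < l e ->
  exists p q, [/\ equivalent (<< pt e (l e / 2) >> + << pt e t >> : divisor G)
                            (<< p >> + << q >>),
    exists v : lol_vertex, q = @vpoint R G v &
    (exists2 s, 0 < s < l e & p = pt e s) \/ p = pt e 0 /\ q = pt e (l e)].
Proof.
move=> te; have half := half_interior e.
have src0 := lolpt_src e; have tgtl := lolpt_tgt e.
move: tgtl half te; set c := l e => tgtl half te.
have inE0 s : 0 <= s <= c -> 0 <= s <= @len R G e by [].
have [t1|t1|t1] := ltgtP t (c / 2).
- exists (pt e (c / 2 + t)), (pt e 0); split; last by left; exists (c / 2 + t) => //; lra.
    by apply: edge_equivalent; first [apply: inE0; lra | lra].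
  by exists (lol_src e).
- exists (pt e (t - c / 2)), (pt e c); split; last by left; exists (t - c / 2) => //; lra.
    by apply: edge_equivalent; first [apply: inE0; lra | lra].
  by exists (lol_tgt e).
- exists (pt e 0), (pt e c); split; last by right.
    by apply: edge_equivalent; first [apply: inE0; lra | lra].
  by exists (lol_tgt e).
Qed.

Lemma blocked_middles (i : 'I_3) p : let e := arc i true in let e' := arc (ordS i) true in
  (forall x, l (link x) <= l (link (ordS i))) ->
  blocked (<< pt e (l e / 2) >> + << pt e' (l e' / 2) >> + << p >>).
Proof.
move=> e e' lj; have ce := half_interior e; have ce' := half_interior e'.
have [[t [te ->]]|Np] := pselect (exists t, 0 < t < l e /\ p = pt e t).
  have [X [Y [eqv [v Yv] XY]]] := edge_middle_equivalent te.
  rewrite addrAC; apply: blocked_equivalent (equivalentDr _ eqv) _.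
  case: XY => [[s se ->]|[-> ->]].
    rewrite addrAC; apply: blocked_rigid => // u ue /eqP.
      by rewrite Yv eq_sym interior_neq_vertex.
    by rewrite Yv eq_sym interior_neq_vertex.
  rewrite lolpt_w lolpt_v.
  (* The delicate case: the chips are at [w_i] and [v_j], and maximality of [link j] allows the
     slide by the length of [link i]. *)
  apply: blocked_equivalent (blocked_link_before (lj i) ce').
  apply/equivalentDr/equivalent_sym.
  have := @links_equivalent R l l_gt0 i (l (link i)) 0 (l (link i)).
  by rewrite subrr add0r; apply; rewrite ?lexx ?lj ?(ltW (l_gt0 _)).
have [[t [te ->]]|Np'] := pselect (exists t, 0 < t < l e' /\ p = pt e' t).
  have [X [Y [eqv [v Yv] XY]]] := edge_middle_equivalent te.
  rewrite -addrA addrC; apply: blocked_equivalent (equivalentDr _ eqv) _.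
  case: XY => [[s se ->]|[-> ->]].
    rewrite addrC addrA; apply: blocked_rigid => // u ue /eqP.
      by rewrite Yv eq_sym interior_neq_vertex.
    by rewrite Yv eq_sym interior_neq_vertex.
  rewrite lolpt_w lolpt_v.
  have := blocked_link_after (lj _) ce; rewrite -addrA addrC.
  apply: blocked_equivalent; apply/equivalentDr/equivalent_sym.
  have := @links_equivalent R l l_gt0 (ordS i)
    (l (link (ordS i))) 0 (l (link (ordS (ordS i)))).
  by rewrite add0r addrC; apply; rewrite ?subr_ge0 ?gerBl ?lexx ?lj ?(ltW (l_gt0 _)).
by apply: blocked_rigid => // t te pt_eq; [apply: Np | apply: Np']; exists t.
Qed.

End NotCovered.

Theorem theorem1p9 (R : realType) (l : lol_edge -> R)
  (l_gt0 : forall e, 0 < l e) :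
  BN_rank (loop_of_loops l_gt0) 1 3 = 0.
Proof.
have [i Hi] := argmax3 (fun x => l (link x)).
have short x : exists b, l (arc x b) <= l (arc x (~~ b)).
  by case/orP: (le_total (l (arc x true)) (l (arc x false))) => H; [exists true | exists false].
have [bj Hbj] := short (ordS i); have [bk Hbk] := short (ordS (ordS i)).
pose t := Num.min (Num.max 0 (l (link i) - l (link (ordS i)) - l (link (ordS (ordS i)))))
  (l (arc (ordS i) bj)).
have t_ge0 : 0 <= t by rewrite le_min le_max lexx /= ltW.
have t_leB : t <= l (arc (ordS i) bj) by rewrite ge_min lexx orbT.
have t_le : t <= l (link i) - l (link (ordS i)).
  by rewrite ge_min ge_max subr_ge0 Hi gerBl ltW.
have cov p : covered (pencil l_gt0 i bj t) p by apply: (pencil_covered (bk := bk)).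
(* With this base index, [ordS i'] is [i]: the loops [i'] and [ordS i'] are the two adjacent to the
   longest link. *)
pose i' := ordS (ordS i).
pose e := arc i' true; pose e' := arc (ordS i') true.
apply: (@BN_rank13_eq0 _ _ (pencil l_gt0 i bj t) (link i) (l (link i) / 2)
  (lolpt l_gt0 e (l e / 2)) (lolpt l_gt0 e' (l e' / 2))) => //.
- exact: half_interior.
- by do 2?apply: effectiveD; apply: effectiveU.
- by rewrite !degD !degU.
- by move=> x; apply: blocked_middles; rewrite ordS3.
Qed.
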